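(* Let $\Omega\subset\mathbb R^n$ be a bounded polyhedral Lipschitz domain with simplicial mesh $\mathcal T$, let $1\le m\le n-1$ and $0\le k\le n$. Then for all $u\in\Lambda^k(\mathcal T)$ $$(C_m^k-C_{m-1}^k)u=\sum_{f\in\Delta_m}K_{m,f}^ku+\sum_{f\in\Delta_{m-1}}K_{m,f}^ku ,$$ where the operators $C_m^k$ and $K_{m,f}^k$ are those defined in the context.
   Context: Mesh. $\mathcal T$ is a finite simplicial decomposition of $\overline\Omega$, with numbered vertices $x_0,\dots,x_N$; simplices are written with increasingly ordered vertices. $\Delta_m$ is the set of $m$-dimensional (sub)simplices, $\Delta_{-1}=\{\emptyset\}$; $\Delta(f)$ is the set of nonempty subsimplices of $f$ (including $f$), $\bar\Delta(f)=\Delta(f)\cup\{\emptyset\}$; $I(f)$ is the set of vertex indices of $f$ and $|f|$ their number; $\sigma_f(x_i)\in\{0,1,\dots\}$ is the position of $x_i$ in $f$; $f(\hat x_i)$ is $f$ with $x_i$ removed; $\langle e,f\rangle$ is the increasingly ordered simplex spanned by the (disjoint) vertices of $e$ and $f$. $\Omega_f$ is the union of the $n$-simplices containing $f$ ($\Omega_\emptyset=\Omega$) and $\mathcal T_f$ the restricted mesh. The link $f^*$ of $f$ is the subcomplex with $\Delta_j(f^* )=\{e\in\Delta_j: e\text{ disjoint from }f,\ \langle e,f\rangle\text{ a simplex of }\mathcal T\}$, $\Delta_{-1}(f^* )=\{\emptyset\}$, $\emptyset^*=\Omega$; $I(f^* )$ is its set of vertex indices, $|f^*|$ their number. For $g\in\bar\Delta(f)$,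 $I(f\cap g^* )=I(f)\setminus I(g)$. $\Delta_{j,m}=\{(e,f):f\in\Delta_m,\ e\in\Delta_j(f^* )\}$ (empty if $j\ge n-m$). Forms. $\Lambda^k(\mathcal T)$: $k$-forms smooth on each closed simplex with single-valued traces on all subsimplices. $\lambda_i$ is the piecewise linear hat function at $x_i$; $\rho_f=1-\sum_{i\in I(f)}\lambda_i$ ($\rho_\emptyset=1$). For an ordered vertex list $f=[x_{j_0},\dots,x_{j_m}]$ the Whitney form is $\phi_f=m!\sum_{i=0}^m(-1)^i\lambda_{j_i}\,d\lambda_{j_0}\wedge\cdots\widehat{d\lambda_{j_i}}\cdots\wedge d\lambda_{j_m}$, with $\phi_\emptyset=1$ and $\phi_f=0$ if the list does not span a simplex of $\mathcal T$. $\mathcal P_1^-\Lambda^k(\mathcal T)=\operatorname{span}\{\phi_e:e\in\Delta_k\}$, $\mathcal P_1^-\Lambda^k(\mathcal T,f^* )=\operatorname{span}\{\phi_e:e\in\Delta_k(f^* )\}$, $\mathcal P_1^-\Lambda^{-1}(\mathcal T,f^* )=\mathbb R$. $V^k(f)$ denotes the forms in $\mathcal P_1^-\Lambda^k(\mathcal T)$ vanishing on $\Omega\setminus\Omega_f$ and with vanishing trace on $\partial\Omega_f$. Chains. For a vector space $X$, $\mathsf C_j(f^* )\otimes X$ is the space of families $(c_e)_{e\in\Delta_j(f^* )}$ in $X$; $(\partial c)_e=\sum_i(-1)^{\sigma_{\langle x_i,e\rangle}(x_i)}c_{\langle x_i,e\rangle}$ for $e\in\Delta_{j-1}(f^* )$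 (sum over $i$ with $\langle x_i,e\rangle\in\Delta_j(f^* )$), $(\delta_jc)_e=\sum_{i\in I(e)}(-1)^{\sigma_e(x_i)}c_{e(\hat x_i)}$ for $e\in\Delta_{j+1}(f^* )$. For $f=[x_{j_0},\dots,x_{j_{m-1}}]\in\Delta_{m-1}$, in the top dimension $n-m$ of $f^*$, $\delta_{n-m}c=\sum_{e\in\Delta_{n-m}(f^* )}o(e,T_e)c_e$ with $T_e=\langle e,f\rangle$, $o(e,T)=o(T)\prod_{i=0}^{m-1}(-1)^{\sigma_{T_i}(x_{j_i})}$, $T_i=T(\hat x_{j_0},\dots,\hat x_{j_{i-1}})$, and $o([y_0,\dots,y_n])=\operatorname{sign}\det(y_1-y_0,\dots,y_n-y_0)$; if $f\subset\partial\Omega$ the condition $\delta_{n-m}c=0$ is void. Functions $\mu,\beta,\psi$. Let $1\le m\le n$, $f\in\Delta_{m-1}$. For $0\le j\le n-m$, $e\in\Delta_j(f^* )$, define $\mu_e=\mu_e(f)\in\mathcal P_1^-\Lambda^{j-1}(\mathcal T,f^* )$ and $\beta_e=\beta_e(f)$ by induction on $j$: $\mu_e=-1/|f^*|$ for $e\in\Delta_0(f^* )$; $\beta_e=\rho_f^{j+1}d(\mu_e/\rho_f^j)+(-1)^j\phi_e$ for $e\in\Delta_j(f^* )$ (for $j=0$, $d$ acts on constants as the inclusion: $\beta_e=\rho_f\mu_e+\phi_e$); for $0\le j<n-m$, $(\mu_e)_{e\in\Delta_{j+1}(f^* )}$ is the unique element of $\mathsf C_{j+1}(f^* )\otimes\mathcal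 P_1^-\Lambda^j(\mathcal T,f^* )$ with $(\partial\mu)_e=\beta_e$ on $\Omega_f$ for all $e\in\Delta_j(f^* )$ and $\delta_{j+1}\mu=0$. For $g\in\bar\Delta(f)$, $\psi_{e,g}(f)=(-1)^{j-1}\sum_{i\in I(f\cap g^* )}(\lambda_id-j\,d\lambda_i\wedge)\mu_e(f)$. Weights. $(\delta^+w)_{e,f}=\sum_{i\in I(e)}(-1)^{\sigma_e(x_i)}w_{e(\hat x_i),\langle x_i,f\rangle}$. The forms $w_{e,f}\in V^{n-j-1}(f)$, $(e,f)\in\Delta_{j,m}$, $0\le m\le n$, $-1\le j<n-m$, are defined by decreasing induction on $m$: for $f\in\Delta_n$, $w_{\emptyset,f}=-(\kappa_f/|\Omega_f|)\,\mathrm{vol}$ ($\kappa_f$ the characteristic function of $\Omega_f$, $\mathrm{vol}$ the volume form). For $1\le m\le n$, $f\in\Delta_{m-1}$ and $-1\le j<n-m$, the $w_{e,f}$, $e\in\Delta_j(f^* )$, are the coefficients in $\sum_{e\in\Delta_j(f^* )}\phi_e\otimes w_{e,f}=(-1)^j\sum_{e\in\Delta_{j+1}(f^* )}\mu_e(f)\otimes(\delta^+w)_{e,f}$; for $j=n-m$ they are the unique elements of $V^{m-1}(f)$ with $\sum_{e\in\Delta_j(f^* )}\phi_e\otimes dw_{e,f}=\sum_{e\in\Delta_j(f^* )}\beta_e(f)\otimes(\delta^+w)_{e,f}$, the first factors being restricted to $\Omega_f$. Put $z_{e,f}=(\delta^+w)_{e,f}$ for $(e,f)\in\Delta_{j,m}$,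 $-1\le m<n$, $0\le j<n-m$. Also $z_f=(\kappa_f/|\Omega_f|)\mathrm{vol}$ for $f\in\Delta_n$ and $z_f=|f^*|^{-1}\sum_{i\in I(f^* )}z_{\langle x_i,f\rangle}$ for $f\in\Delta_m$, $0\le m<n$. Operators. $\mathcal S_f^c=\{\lambda=(\lambda_i)_{i\in I(f)}:\lambda_i\ge0,\sum\lambda_i\le1\}$, $\mathcal S_\emptyset^c=\{0\}$, $b(\lambda)=1-\sum\lambda_i$; for $g\in\bar\Delta(f)$, $\mathcal S_g^c$ is identified with the face $\{\lambda_i=0,\ i\notin I(g)\}$ of $\mathcal S_f^c$, and $L_g:\Omega\to\mathcal S_g^c$, $L_g(x)=(\lambda_i(x))_{i\in I(g)}$, with pullback $L_g^*$ (so $L_g^*b=\rho_g$, and $L_g^*b^{-j}R$ means $L_g^*(b^{-j}R)$). $G_f:\Omega_f\times\mathcal S_f^c\to\Omega_f$, $G_f(y,\lambda)=\sum_{i\in I(f)}\lambda_ix_i+b(\lambda)y$. $\Pi_j$ is the canonical projection of $k$-forms on $\Omega_f\times\mathcal S_f^c$ onto $\Lambda^j(\Omega_f)\otimes\Lambda^{k-j}(\mathcal S_f^c)$ ($\alpha\wedge\beta$ identified with $\alpha\otimes\beta$; $\Pi_j=0$ for $j>k$), and $\int_\Omega(\alpha\otimes\beta)\wedge w=(\int_\Omega\alpha\wedge w)\beta$. Define $A_f^ku=\int_\Omega G_f(y,\cdot)^*u\wedge z_f$, and for $(e,f)\in\Delta_{j,m}$: $R_{e,f}^ku=\int_\Omega\Pi_jG_f^*u\wedge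 z_{e,f}$ and $Q_{e,f}^ku=\int_\Omega\Pi_{j+1}G_f^*u\wedge w_{e,f}$. Expressions with $\rho_g$ in a denominator are understood off the zero set of $\rho_g$. For $0\le m\le n-1$, $$C_m^ku=\sum_{f\in\Delta_m}\sum_{g\in\bar\Delta(f)}(-1)^{|f|-|g|}L_g^*A_f^ku+\sum_{j=0}^{n-m}\sum_{(e,f)\in\Delta_{j,m-1}}(-1)^{j-1}\sum_{g\in\bar\Delta(f)}(-1)^{|f|-|g|}\frac{\phi_e}{\rho_g}\wedge L_g^*b^{-j}R_{e,f}^ku .$$ For $1\le m\le n-1$ and $f\in\Delta_m$, $K_{m,f}^ku=\sum_{g\in\bar\Delta(f)}(-1)^{|f|-|g|}L_g^*A_f^ku$; for $f\in\Delta_{m-1}$, $K_{m,f}^k=\sum_{g\in\bar\Delta(f)}(-1)^{|f|-|g|}K_{m,f,g}^k$ with $$K_{m,f,g}^ku=-L_g^*A_f^ku+\sum_{j=0}^{n-m}\frac{(-1)^{j-1}}{\rho_g^{j+1}}\sum_{e\in\Delta_j(f^* )}(\phi_e+\psi_{e,g}(f))\wedge L_g^*R_{e,f}^ku+(-1)^{n-m}\sum_{e\in\Delta_{n-m}(f^* )}d\Big(\frac{\phi_e}{\rho_g^{n-m+1}}\Big)\wedge L_g^*Q_{e,f}^ku .$$ *)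

(* Defs.v *)
From HB Require Import structures.
From mathcomp Require Import all_boot all_order all_algebra.
From mathcomp Require Import all_classical all_reals all_analysis.

Set Implicit Arguments.
Unset Strict Implicit.
Unset Printing Implicit Defensive.

Import Order.TTheory GRing.Theory Num.Theory.
Import numFieldNormedType.Exports.

Local Open Scope classical_set_scope.
Local Open Scope ring_scope.

(* Powers m \x ... \x m of a sigma-finite measure, on the product
   sigma-algebra of n.-tuple T; Lebesgue measure on R^n is the power of the
   one-dimensional one. *)
Section TuplePower.
Context d (T : measurableType d) (R : realType) (n : nat).
Variable m : {sigma_finite_measure set T -> \bar R}.
Variable mu : {sigma_finite_measure set (n.-tuple T) -> \bar R}.

Definition tcons (p : T * n.-tuple T) : n.+1.-tuple T :=
  [the n.+1.-tuple T of p.1 :: p.2].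

Lemma measurable_tcons : measurable_fun [set: T * n.-tuple T] tcons.
Proof. by apply: measurable_cons; [exact: measurable_fst|exact: measurable_snd]. Qed.

Definition power_succ : set (n.+1.-tuple T) -> \bar R :=
  pushforward (m \x mu)%E tcons.

Let ps0 : power_succ set0 = 0%E.
Proof. by rewrite /power_succ /pushforward preimage_set0 measure0. Qed.

Let ps_ge0 A : (0 <= power_succ A)%E.
Proof. by rewrite /power_succ /pushforward; exact: measure_ge0. Qed.

Let ps_sigma_additive : semi_sigma_additive power_succ.
Proof.
move=> F mF tF mUF; rewrite /power_succ /pushforward preimage_bigcup.
have mpre A : measurable A -> measurable (tcons @^-1` A).
  by move=> mA; rewrite -[X in measurable X]setTI; exact: measurable_tcons.
apply: measure_semi_sigma_additive.
- by move=> i; exact: mpre.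
- apply/trivIsetP => i j _ _ ij; rewrite -preimage_setI.
  by move/trivIsetP : tF => /(_ _ _ _ _ ij) ->//; rewrite preimage_set0.
- by rewrite -preimage_bigcup; exact: mpre.
Qed.

HB.instance Definition _ := isMeasure.Build _ _ _ power_succ
  ps0 ps_ge0 ps_sigma_additive.

Let ps_sigma_finite : sigma_finite setT power_succ.
Proof.
have [F FT mF] : sigma_finite setT (m \x mu)%E.
  have /sigma_finiteP[F [TF ndF Foo]] := sigma_finiteT m.
  have /sigma_finiteP[G [TG ndG Goo]] := sigma_finiteT mu.
  exists (fun i => F i `*` G i).
    rewrite -setXTT TF TG predeqE => -[x y]; split.
      move=> [/= [i _ Fix] [j _ Gjy]]; exists (maxn i j) => //; split.
      - by move: x Fix; exact/subsetPset/ndF/leq_maxl.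
      - by move: y Gjy; exact/subsetPset/ndG/leq_maxr.
    by move=> [i _ []/= ? ?]; split; exists i.
  move=> k; have [? ?] := Foo k; have [? ?] := Goo k.
  split; first exact: measurableX.
  by rewrite product_measure1E// lte_mul_pinfty// ge0_fin_numE.
pose un (t : n.+1.-tuple T) : T * n.-tuple T := (thead t, [tuple of behead t]).
have mun : measurable_fun [set: n.+1.-tuple T] un.
  apply/measurable_fun_pairP; split; first exact: measurable_tnth.
  exact: measurable_behead.
have unK : cancel tcons un.
  by move=> [a t]; rewrite /un /tcons /=; congr pair; apply: val_inj.
exists (fun i => un @^-1` F i).
  by rewrite -preimage_bigcup -FT preimage_setT.
move=> i; have [mFi Fioo] := mF i; split.
  by rewrite -[X in measurable X]setTI; exact: mun.
rewrite /power_succ /pushforward -comp_preimage.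
by rewrite (_ : un \o tcons = id) //; apply/funext => p /=; rewrite unK.
Qed.

HB.instance Definition _ := Measure_isSigmaFinite.Build _ _ _ power_succ
  ps_sigma_finite.

End TuplePower.

Fixpoint power_measure d (T : measurableType d) (R : realType)
    (m : {sigma_finite_measure set T -> \bar R}) (n : nat) :
    {sigma_finite_measure set (n.-tuple T) -> \bar R} :=
  match n with
  | 0 => \d_([tuple] : 0.-tuple T)
  | n'.+1 => power_succ m (power_measure m n')
  end.

Definition lebesgue_tuple (R : realType) (n : nat) :=
  power_measure (@lebesgue_measure R) n.

Section Forms.
Context (R : realType).

(* An element of the exterior algebra of W^*, given by its values on finite
   lists of vectors; a k-form is one that vanishes off lists of size k. *)
Definition alt (W : Type) := seq W -> R.

Definition is_kform (W : lmodType R) (k : nat) (a : alt W) : Prop :=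
  [/\ forall vs, size vs != k -> a vs = 0,
      forall us vs c v w, a (us ++ (c *: v + w) :: vs) =
                          c * a (us ++ v :: vs) + a (us ++ w :: vs)
    & forall us vs ws v, a (us ++ v :: vs ++ v :: ws) = 0].

(* The exterior product in the determinant normalization (a sum over
   shuffles), unfolded one vector at a time: contraction with v is an
   antiderivation, v _| (a /\ b) = (v _| a) /\ b + (-1)^(deg a) a /\ (v _| b). *)
Fixpoint wedge (W : Type) (a b : alt W) (vs : seq W) : R :=
  match vs with
  | [::] => a [::] * b [::]
  | v :: vs' => wedge (fun us => a (v :: us)) b vs' +
      wedge (fun us => (-1) ^+ size us * a us) (fun us => b (v :: us)) vs'
  end.

Definition unit_form (W : Type) : alt W := fun vs => (nilp vs)%:R.

Definition extd (V : normedModType R) (u : V -> alt V) : V -> alt V :=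
  fun x vs => \sum_(i < size vs) (-1) ^+ i *
    'D_(nth 0 vs i) (fun y => u y (take i vs ++ drop i.+1 vs)) x.

Definition pull (V W : normedModType R) (F : V -> W) (u : W -> alt W) :
    V -> alt V :=
  fun x vs => u (F x) [seq 'D_v F x | v <- vs].

(* The component of type (j, _) of a form on V * W, as a function of j
   vectors of V and a list of vectors of W. *)
Definition bicomp (V W : lmodType R) (j : nat) (a : alt (V * W)%type)
    (vs : seq V) (ws : seq W) : R :=
  if size vs == j then a ([seq (v, 0) | v <- vs] ++ [seq (0, w) | w <- ws])
  else 0.

Fixpoint Cr (V : normedModType R) (r : nat) (h : V -> R) : Prop :=
  continuous h /\
  match r with
  | 0 => True
  | r'.+1 => (forall x v, derivable h x v) /\
             (forall v, Cr r' (fun x => 'D_v h x))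
  end.

Definition Cinfty (V : normedModType R) (h : V -> R) := forall r, Cr r h.

End Forms.

Section Euclidean.
Context (R : realType) (n : nat).
Local Notation V := 'rV[R]_n.

Definition dot (v w : V) : R := (v *m w^T) 0 0.

Definition bdry (A : set V) : set V := closure A `\` interior A.

(* Near every boundary point, Omega is the open epigraph of a Lipschitz
   function over the hyperplane orthogonal to some unit vector. *)
Definition lipschitz_domain (Omega : set V) : Prop :=
  [/\ open Omega, connected Omega, Omega !=set0, bounded_set Omega
    & forall p, bdry Omega p ->
      exists v : V, dot v v = 1 /\
      exists (h : V -> R) (L : R), L.-lipschitz h /\
        \forall x \near p, Omega x <-> h (x - dot x v *: v) < dot x v].

Definition vec_of_tuple (t : n.-tuple (measurableTypeR R)) : V :=
  \row_i tnth t i.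

Definition integral_on (A : set V) (h : V -> R) : R :=
  \int[lebesgue_tuple R n]_(t in vec_of_tuple @^-1` A) h (vec_of_tuple t).

Definition volume (A : set V) : R :=
  fine (lebesgue_tuple R n (vec_of_tuple @^-1` A)).

Definition std_basis : seq V := [seq delta_mx 0 i | i <- enum 'I_n].

Definition vol_form : alt R V := fun vs =>
  if size vs == n then \det (\matrix_(i < n, j < n) (nth 0 vs i) 0 j) else 0.

End Euclidean.

(* A simplex is the set of the indices of its vertices; K is the set of all
   simplices of the mesh, including the empty one, so that those of dimension
   d are the f \in K with #|f| = d + 1. *)
Section Mesh.
Context (R : realType) (n N : nat).
Local Notation V := 'rV[R]_n.
Local Notation W := 'rV[R]_N.+1.
Local Notation simplex := {set 'I_N.+1}.
Variables (x : 'I_N.+1 -> V) (K : {set simplex}).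

Definition simplices (c : nat) : {set simplex} := [set f in K | #|f| == c].

Local Notation cells := (simplices n.+1).

Definition hull (f : simplex) : set V := [set p | exists a : 'I_N.+1 -> R,
  [/\ forall i, 0 <= a i, forall i, i \notin f -> a i = 0,
      \sum_i a i = 1 & p = \sum_i a i *: x i]].

Definition tangent (f : simplex) : set V := [set v | exists a : 'I_N.+1 -> R,
  [/\ forall i, i \notin f -> a i = 0, \sum_i a i = 0
    & v = \sum_i a i *: x i]].

(* The vertices of T in increasing order. *)
Definition vertex (T : simplex) (a : nat) : V := x (nth ord0 (enum T) a).

Definition bary_mx (T : simplex) : 'M[R]_n.+1 :=
  \matrix_(a < n.+1) (row_mx 1 (vertex T a) : 'rV_(1 + n)).

Definition is_mesh (Omega : set V) : Prop :=
  [/\ [/\ finset.set0 \in K, forall i, [set i]%SET \in K &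
          forall f g : simplex, f \in K -> g \subset f -> g \in K],
      forall f, f \in K -> exists2 T, T \in cells & f \subset T,
      forall T, T \in cells -> bary_mx T \in unitmx,
      forall f g, f \in K -> g \in K ->
        hull f `&` hull g = hull (f :&: g)%SET
    & \bigcup_(T in [set T | T \in cells]) hull T = closure Omega].

(* Barycentric coordinate number i on the n-simplex T, extended to R^n: the
   coordinates l of p solve (1, p) = l *m bary_mx T. *)
Definition lambda (i : 'I_N.+1) (T : simplex) (p : V) : R :=
  if i \in T then
    ((row_mx 1 p : 'rV_(1 + n)) *m invmx (bary_mx T)) 0
      (inord (index i (enum T)))
  else 0.

Definition rho (f T : simplex) (p : V) : R := 1 - \sum_(i in f) lambda i T p.

(* Piecewise forms: one form for each n-simplex T, whose values on T are the
   meaningful ones. A piecewise polynomial form is given on each T by its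
   polynomial on all of R^n, so that derivatives at points of the boundary of
   T are those of this polynomial. *)
Definition pform := simplex -> V -> alt R V.

Definition dlambda (i : 'I_N.+1) : pform := fun T =>
  extd (fun p vs => lambda i T p * unit_form R vs).

Definition pos (f : simplex) (i : 'I_N.+1) : nat :=
  #|[set l in f | (l < i)%N]%SET|.

Definition whitney (f : simplex) : pform := fun T p =>
  if f \notin K then fun=> 0 else if f == finset.set0 then @unit_form R V else
  fun vs => (#|f|.-1)`!%:R * \sum_(i in f) (-1) ^+ pos f i * lambda i T p *
    (\big[@wedge R V/@unit_form R V]_(l <- enum (f :\ i)%SET) dlambda l T p) vs.

Definition smooth_forms (k : nat) (u : pform) : Prop :=
  (forall T, T \in cells ->
     (forall p, hull T p -> is_kform k (u T p)) /\
     (forall vs, exists2 h : V -> R, Cinfty h &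
        forall p, hull T p -> u T p vs = h p)) /\
  (forall T T' f, T \in cells -> T' \in cells -> f \in K ->
     f \subset T -> f \subset T' ->
     forall p vs, hull f p -> (forall v, v \in vs -> tangent f v) ->
       u T p vs = u T' p vs).

Definition whitney_span (S : {set simplex}) (u : pform) : Prop :=
  exists a : simplex -> R, forall T, T \in cells ->
    forall p vs, u T p vs = \sum_(e in S) a e * whitney e T p vs.

(* The simplices with c vertices of the link of f. *)
Definition link (f : simplex) (c : nat) : {set simplex} :=
  [set e in K | [&& #|e| == c, [disjoint e & f] & (e :|: f)%SET \in K]].

Definition link_vertices (f : simplex) : {set 'I_N.+1} :=
  [set i | [set i]%SET \in link f 1].

Definition star (f : simplex) : set V :=
  \bigcup_(T in [set T | T \in cells /\ f \subset T]) hull T.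

Definition V_forms (k : nat) (f : simplex) (u : pform) : Prop :=
  [/\ whitney_span (simplices k.+1) u,
      forall T p vs, T \in cells -> ~~ (f \subset T) -> hull T p ->
        u T p vs = 0
    & forall s T p vs, s \in K -> hull s `<=` bdry (star f) ->
        T \in cells -> s \subset T -> hull s p ->
        (forall v, v \in vs -> tangent s v) -> u T p vs = 0].

Definition boundary (f : simplex) (c : simplex -> pform) (e : simplex) :
    pform := fun T p vs =>
  \sum_(i | (i |: e)%SET \in link f #|e|.+1)
    (-1) ^+ pos (i |: e)%SET i * c (i |: e)%SET T p vs.

Definition coboundary (c : simplex -> pform) (e : simplex) : pform :=
  fun T p vs => \sum_(i in e) (-1) ^+ pos e i * c (e :\ i)%SET T p vs.

Definition orientation (T : simplex) : R :=
  Num.sg (\det (\matrix_(a < n) (vertex T a.+1 - vertex T 0))).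

Definition rel_orientation (f e T : simplex) : R :=
  orientation T *
  \prod_(i in f) (-1) ^+ pos (T :\: [set l in f | (l < i)%N])%SET i.

(* d on forms of degree j - 1; in degree -1, the inclusion of the constants
   in the 0-forms. *)
Definition extd_aug (j : nat) (u : pform) : pform :=
  if j is 0 then u else fun T => extd (u T).

Definition beta (f : simplex) (mu : simplex -> pform) (e : simplex) : pform :=
  fun T p vs => let j := #|e|.-1 in
  rho f T p ^+ j.+1 *
    extd_aug j (fun T q ws => mu e T q ws / rho f T q ^+ j) T p vs
  + (-1) ^+ j * whitney e T p vs.

Definition is_mu (Omega : set V) (f : simplex) (mu : simplex -> pform) :
    Prop :=
  let m := #|f| in
  [/\ forall e T p vs, e \in link f 1 -> T \in cells -> hull T p ->
        mu e T p vs = - #|link_vertices f|%:R^-1 * unit_form R vs,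
      forall j e, (j < n - m)%N -> e \in link f j.+2 ->
        whitney_span (link f j.+1) (mu e),
      forall j e T p vs, (j < n - m)%N -> e \in link f j.+1 ->
        T \in cells -> f \subset T -> hull T p -> rho f T p != 0 ->
        boundary f mu e T p vs = beta f mu e T p vs,
      forall j e T p vs, (j.+1 < n - m)%N -> e \in link f j.+3 ->
        T \in cells -> hull T p -> coboundary mu e T p vs = 0
    & (m < n)%N -> ~ (hull f `<=` bdry Omega) ->
        forall T p vs, T \in cells -> hull T p ->
        \sum_(e in link f (n - m).+1)
          rel_orientation f e (e :|: f)%SET * mu e T p vs = 0].

Definition psi (f : simplex) (mu : simplex -> pform) (e g : simplex) : pform :=
  fun T p vs => let j := #|e|.-1 in
  (-1) ^+ j.+1 * \sum_(i in (f :\: g)%SET)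
    (lambda i T p * extd_aug j (mu e) T p vs
     - j%:R * wedge (dlambda i T p) (mu e T p) vs).

Definition delta_plus (w : simplex -> simplex -> pform) (e f : simplex) :
    pform := fun T p vs =>
  \sum_(i in e) (-1) ^+ pos e i * w (e :\ i)%SET (i |: f)%SET T p vs.

Definition unit_volume_form (f : simplex) : pform := fun T p vs =>
  if T == f then vol_form vs / volume (hull f) else 0.

(* Identities between elements of a tensor product of two spaces of forms are
   stated pointwise in the two variables. In terms of c = j + 1, the condition
   j < n - m reads c <= n - m. *)
Definition is_weights (mu : simplex -> simplex -> pform)
    (w : simplex -> simplex -> pform) : Prop :=
  [/\ forall f e : simplex, f \in K -> f != finset.set0 -> e \in link f #|e| ->
        V_forms (n - #|e|) f (w e f),
      forall f T p vs, f \in cells -> T \in cells -> hull T p ->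
        w finset.set0 f T p vs = - unit_volume_form f T p vs,
      forall f c, f \in K -> (0 < #|f| <= n)%N -> (c <= n - #|f|)%N ->
        forall T p vs T' q ws, T \in cells -> f \subset T -> hull T p ->
        T' \in cells -> hull T' q ->
        \sum_(e in link f c) whitney e T p vs * w e f T' q ws =
        (-1) ^+ c.+1 * \sum_(e in link f c.+1)
          mu f e T p vs * delta_plus w e f T' q ws
    & forall f, f \in K -> (0 < #|f| <= n)%N ->
        forall T p vs T' q ws, T \in cells -> f \subset T -> hull T p ->
        rho f T p != 0 -> T' \in cells -> hull T' q ->
        \sum_(e in link f (n - #|f|).+1)
          whitney e T p vs * extd (w e f T') q ws =
        \sum_(e in link f (n - #|f|).+1)
          beta f (mu f) e T p vs * delta_plus w e f T' q ws].

(* z_f for f of codimension d. *)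
Fixpoint zf_rec (d : nat) (f : simplex) : pform :=
  if d is d'.+1 then fun T p vs =>
    #|link_vertices f|%:R^-1 *
    \sum_(i in link_vertices f) zf_rec d' (i |: f)%SET T p vs
  else unit_volume_form f.

Definition zf (f : simplex) : pform := zf_rec (n.+1 - #|f|) f.

(* All the simplices S^c_f are realized in R^(N+1): S^c_f has its points and
   tangent vectors supported in f, and S^c_g is a face of S^c_f. *)
Definition bS (f : simplex) (l : W) : R := 1 - \sum_(i in f) l 0 i.

Definition Gmap (f : simplex) (y : (V * W)%type) : V :=
  \sum_(i in f) y.2 0 i *: x i + bS f y.2 *: y.1.

Definition Lmap (g T : simplex) (p : V) : W :=
  \row_i (if i \in g then lambda i T p else 0).

Definition Lpull (g : simplex) (r : W -> alt R W) : pform :=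
  fun T => pull (Lmap g T) r.

Definition Aop (f : simplex) (u : pform) : W -> alt R W := fun l ws =>
  \sum_(T in cells | f \subset T) integral_on (hull T) (fun y =>
    pull (fun l' => Gmap f (y, l')) (u T) l ws * zf f T y (std_basis R n)).

(* The fiber integral over Omega_f, off which z vanishes in all uses, of the
   component of type (j, _) of G_f^* u wedged with z. *)
Definition fiber_int (j : nat) (f : simplex) (z u : pform) : W -> alt R W :=
  fun l ws =>
  \sum_(T in cells | f \subset T) integral_on (hull T) (fun y =>
    wedge (fun vs => bicomp j (pull (Gmap f) (u T) (y, l)) vs ws) (z T y)
      (std_basis R n)).

Variables (mu w : simplex -> simplex -> pform).

Definition Rop (e f : simplex) (u : pform) : W -> alt R W :=
  fiber_int #|e|.-1 f (delta_plus w e f) u.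

Definition Qop (e f : simplex) (u : pform) : W -> alt R W :=
  fiber_int #|e| f (w e f) u.

Definition altsum (f : simplex) (F : simplex -> pform) : pform :=
  fun T p vs => \sum_(g in powerset f) (-1) ^+ (#|f| - #|g|) * F g T p vs.

Definition Cop (m : nat) (u : pform) : pform := fun T p vs =>
  \sum_(f in simplices m.+1)
    altsum f (fun g => Lpull g (Aop f u)) T p vs +
  \sum_(j < (n - m).+1) \sum_(f in simplices m) \sum_(e in link f j.+1)
    (-1) ^+ j.+1 * altsum f (fun g T p =>
      wedge (fun us => whitney e T p us / rho g T p)
        (Lpull g (fun l ws => bS f l ^- j * Rop e f u l ws) T p)) T p vs.

Definition Kfg (m : nat) (f g : simplex) (u : pform) : pform :=
  fun T p vs =>
  - Lpull g (Aop f u) T p vs +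
  \sum_(j < (n - m).+1) (-1) ^+ j.+1 / rho g T p ^+ j.+1 *
    \sum_(e in link f j.+1)
      wedge (fun us => whitney e T p us + psi f (mu f) e g T p us)
        (Lpull g (Rop e f u) T p) vs +
  (-1) ^+ (n - m) * \sum_(e in link f (n - m).+1)
    wedge (extd (fun q us => whitney e T q us / rho g T q ^+ (n - m).+1) p)
      (Lpull g (Qop e f u) T p) vs.

Definition Kop (m : nat) (f : simplex) (u : pform) : pform :=
  if #|f| == m.+1 then altsum f (fun g => Lpull g (Aop f u))
  else altsum f (fun g => Kfg m f g u).

End Mesh.

(* Main.v *)
Require Import Defs.
From mathcomp Require Import all_boot all_order all_algebra.
From mathcomp Require Import all_classical all_reals all_analysis.
From mathcomp Require Import measurable_realfun ring lra zify.

Set Implicit Arguments.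
Unset Strict Implicit.
Unset Printing Implicit Defensive.

Import Order.TTheory GRing.Theory Num.Theory.
Import numFieldNormedType.Exports.
Local Open Scope ring_scope.

(** The terms in A_f cancel, and so do the terms with phi_e in K_{m,f} against
    the second sum of C_m, because L_g^* b = rho_g. What is left is to show
    that the second sum of C_{m-1} is, up to sign, the alternating sum over g
    of the remaining terms of K_{m,f} (those with psi_{e,g} and with Q_{e,f}),
    summed over the f with m vertices.

    The sum of C_{m-1} runs over simplices f' with m - 1 vertices and contains
    R_{e,f'}, the fiber integral against (delta^+ w)_{e,f'}. Expanding delta^+
    moves one vertex i of e to f', and since the points L_g(x) lie in the face
    S_{f'} of S_f for f = <x_i, f'>, each summand is a Q_{e',f} with
    e' = e - x_i ([Rop_split]). Reindexing by (f, e', g, i) ([reindex_link],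
    [Cop_cone_part]) gives, for every g in f, the forms
    sum_i phi_[x_i, e'] paired with L_g^* Q_{e',f}, where i runs over the
    vertices of f not in g. Everything now rests on the cone formula
    ([cone_op_whitney])

        phi_[x_i, e] = lambda_i d phi_e - (j + 1) d lambda_i /\ phi_e,
                                                          j = dim e.

    Below the top dimension of the link, apply the operator
    lambda_i d - (j + 1) d lambda_i /\ to the first factors of the tensor
    identity that defines the weights: it turns the phi_e into cones and the
    mu_e into the summands of psi_{e,g} ([cone_op_tensor],
    [sum_wedge_cone_sum]). This is legitimate since both sides are affine in
    the first variable, and an affine function that vanishes on a cell
    vanishes identically. In the top dimension,
    d(phi_e / rho_g^(j+1)) rho_g^(j+2) is the sum of the cones over all
    vertices of the cell outside g, because rho_g is the sum of their
    barycentric coordinates; the cones from the vertices of e itself vanish,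
    and the others are those of f ([extd_whitney_top]).

    All this holds on the cells containing f. On any other cell some lambda_i
    with x_i in f is zero, nothing changes when x_i is added to g, and the
    alternating sums over g vanish on both sides ([altsum_K_rest]).

    Exchanging finite sums with the fiber integrals needs integrability: on a
    cell the integrand is the restriction of a continuous function, a cell is
    closed and bounded, and continuous functions are measurable for the
    product sigma-algebra since open sets are countable unions of rational
    boxes. *)

(** * The exterior product *)

Section Wedge.
Variables (R : realType) (W : Type).
Implicit Types (a b c : alt R W) (vs us : seq W).

(** The exterior product is bilinear, so it factors through the tensor
    product: families that agree as elements of the tensor product, tested
    pointwise, have the same sum of exterior products. *)
Lemma wedge_tensor (I J : finType) (P : pred I) (Q : pred J)
    (a b : I -> alt R W) (a' b' : J -> alt R W) vs :
  (forall us ws, \sum_(i | P i) a i us * b i ws =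
                 \sum_(j | Q j) a' j us * b' j ws) ->
  \sum_(i | P i) wedge (a i) (b i) vs = \sum_(j | Q j) wedge (a' j) (b' j) vs.
Proof.
elim: vs a b a' b' => [|v vs IH] a b a' b' H /=; first exact: H.
rewrite !big_split /=; congr (_ + _); apply: IH => us ws; first exact: H.
by under eq_bigr do rewrite -mulrA; under [RHS]eq_bigr do rewrite -mulrA;
   rewrite -!mulr_sumr H.
Qed.

Lemma wedge_suml (I : Type) (r : seq I) (P : pred I) (a : I -> alt R W) b vs :
  wedge (fun us => \sum_(i <- r | P i) a i us) b vs =
  \sum_(i <- r | P i) wedge (a i) b vs.
Proof.
elim: vs a b => [|v vs IH] a b /=; first by rewrite mulr_suml.
by under [X in _ + wedge X _ _]eq_fun do rewrite mulr_sumr; rewrite big_split /= !IH.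
Qed.

Lemma wedge_sumr (I : Type) (r : seq I) (P : pred I) a (b : I -> alt R W) vs :
  wedge a (fun us => \sum_(i <- r | P i) b i us) vs =
  \sum_(i <- r | P i) wedge a (b i) vs.
Proof.
elim: vs a b => [|v vs IH] a b /=; first by rewrite mulr_sumr.
by rewrite big_split /= !IH.
Qed.

Lemma wedgeZl (k : R) a b vs :
  wedge (fun us => k * a us) b vs = k * wedge a b vs.
Proof.
elim: vs a b => [|v vs IH] a b /=; first by rewrite mulrA.
by rewrite mulrDr -!IH; under [X in _ + wedge X _ _]eq_fun do rewrite mulrCA.
Qed.

Lemma wedgeZr (k : R) a b vs :
  wedge a (fun us => k * b us) vs = k * wedge a b vs.
Proof.
elim: vs a b => [|v vs IH] a b /=; first by rewrite mulrCA.
by rewrite mulrDr -!IH.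
Qed.

Lemma wedgeDl a a' b vs :
  wedge (fun us => a us + a' us) b vs = wedge a b vs + wedge a' b vs.
Proof.
elim: vs a a' b => [|v vs IH] a a' b /=; first by rewrite mulrDl.
by under [X in _ + wedge X _ _]eq_fun do rewrite mulrDr; rewrite !IH addrACA.
Qed.

Lemma wedgeDr a b b' vs :
  wedge a (fun us => b us + b' us) vs = wedge a b vs + wedge a b' vs.
Proof.
elim: vs a b b' => [|v vs IH] a b b' /=; first by rewrite mulrDr.
by rewrite !IH addrACA.
Qed.

Lemma wedge0l b vs : wedge (fun=> 0) b vs = 0.
Proof.
elim: vs b => [|v vs IH] b /=; first by rewrite mul0r.
by under [X in _ + wedge X _ _]eq_fun do rewrite mulr0; rewrite !IH addr0.
Qed.

Lemma wedge0r a vs : wedge a (fun=> 0) vs = 0.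
Proof.
by elim: vs a => [|v vs IH] a /=; rewrite ?mulr0 // !IH addr0.
Qed.

(** Only the degree is recorded: the argument list having length one already
    makes the exterior product on the left an alternating sum of contractions. *)
Definition oneform a := forall vs, size vs != 1%N -> a vs = 0.

Lemma wedge_scalar (k : R) b vs :
  wedge (fun us => k * unit_form R us) b vs = k * b vs.
Proof.
elim: vs b => [|v vs IH] b /=; first by rewrite mulr1.
rewrite (_ : (fun us => _) = fun=> 0); last by apply/funext => us; rewrite mulr0.
rewrite wedge0l add0r -(IH (fun us => b (v :: us))); congr wedge; apply/funext => -[|w us] /=.
  by rewrite mul1r.
by rewrite !mulr0.
Qed.

(** Contraction with v is an antiderivation, and the contraction of a 1-form
    is a scalar. *)
Lemma wedge1_cons a b v vs : oneform a ->
  wedge a b (v :: vs) = a [:: v] * b vs - wedge a (fun us => b (v :: us)) vs.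
Proof.
move=> a1 /=; congr (_ + _).
  rewrite -(wedge_scalar (a [:: v]) b); congr wedge; apply/funext => -[|w us].
    by rewrite mulr1.
  by rewrite /= mulr0 a1.
rewrite -[RHS]mulN1r -wedgeZl; congr wedge; apply/funext => us.
by have [->|/a1 ->] := eqVneq (size us) 1%N; rewrite ?expr1 ?mulr0.
Qed.

Lemma wedge1E (v0 : W) a b vs : oneform a ->
  wedge a b vs = \sum_(i < size vs) (-1) ^+ i *
    (a [:: nth v0 vs i] * b (take i vs ++ drop i.+1 vs)).
Proof.
move=> a1; elim: vs b => [|v vs IH] b.
  by rewrite big_ord0 /= a1 ?mul0r.
rewrite wedge1_cons // IH big_ord_recl /= drop0 mul1r -sumrN; congr (_ + _).
by apply: eq_bigr => i _; rewrite exprS mulN1r mulNr.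
Qed.

(** The antiderivation rule applied twice gives the sign, by induction on the
    arguments. *)
Lemma wedge1_anticomm a b c vs : oneform a -> oneform b ->
  wedge a (wedge b c) vs = - wedge b (wedge a c) vs.
Proof.
move=> a1 b1; elim: vs c => [|v vs IH] c.
  by rewrite /= a1 // b1 // !mul0r oppr0.
have E f g : oneform f -> oneform g ->
    wedge f (wedge g c) (v :: vs) = f [:: v] * wedge g c vs
      - (g [:: v] * wedge f c vs - wedge f (wedge g (fun us => c (v :: us))) vs).
  move=> f1 g1; rewrite wedge1_cons //; congr (_ - _).
  under [X in wedge _ X]eq_fun do rewrite wedge1_cons // -mulN1r.
  by rewrite wedgeDr !wedgeZr mulN1r.
by rewrite !E // IH; ring.
Qed.

End Wedge.

(** * Affine functions and barycentric coordinates *)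

Section Affine.
Local Open Scope classical_set_scope.
Local Open Scope ring_scope.
Variables (R : realType).

(** The difference quotient is constant when F is affine along the line. This
    covers lambda_i, L_g and, in each of its two variables, G_f. *)
Lemma derive_line (V W : normedModType R) (F : V -> W) (v : V) (c : W) p :
  (forall t, F (t *: v + p) = F p + t *: c) ->
  derivable F p v /\ 'D_v F p = c.
Proof.
move=> H; rewrite /derivable /derive.
have E : (fun h : R => h^-1 *: ((F \o shift p) (h *: v) - F p)) @ 0^' --> c.
  apply: cvg_near_cst; near=> h.
  have h0 : h != 0 by near: h; exact: nbhs_dnbhs_neq.
  by rewrite /= H addrAC subrr add0r scalerA mulVf ?scale1r.
split; [by apply: cvgP E|exact: cvg_lim].
Unshelve. all: by end_near.
Qed.

Variables (V : normedModType R).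
Implicit Types (h : V -> R) (v p : V).

(** An affine function is characterized by its behaviour along lines, its
    linear part being h v - h 0; no matrix has to be named. *)
Definition affine h := forall t v p, h (t *: v + p) = h p + t * (h v - h 0).

Lemma derive_affine h v p : affine h -> 'D_v h p = h v - h 0.
Proof. by move=> hA; apply: (derive_line _).2 => t; exact: hA. Qed.

Lemma derivable_affine h v p : affine h -> derivable h p v.
Proof. by move=> hA; apply: (derive_line _).1 => t; exact: hA. Qed.

Lemma affine_cst (c : R) : affine (fun=> c).
Proof. by move=> t v p; rewrite subrr mulr0 addr0. Qed.

Lemma affineD h h' : affine h -> affine h' -> affine (fun p => h p + h' p).
Proof. by move=> hA hA' t v p; rewrite hA hA'; ring. Qed.

Lemma affineZ (c : R) h : affine h -> affine (fun p => c * h p).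
Proof. by move=> hA t v p; rewrite hA; ring. Qed.

Lemma affine_sum (I : Type) (r : seq I) (P : pred I) (h : I -> V -> R) :
  (forall i, P i -> affine (h i)) ->
  affine (fun p => \sum_(i <- r | P i) h i p).
Proof.
move=> hA t v p; rewrite -sumrB mulr_sumr -big_split /=.
by apply: eq_bigr => i Pi; rewrite hA.
Qed.

Lemma affine_sumE h (I : finType) (P : pred I) (a : I -> R) (x : I -> V) :
  affine h -> h (\sum_(i | P i) a i *: x i) =
              h 0 + \sum_(i | P i) a i * (h (x i) - h 0).
Proof.
move=> hA; elim/big_rec2: _ => [|i y z _ IH]; first by rewrite addr0.
by rewrite hA IH; ring.
Qed.

Lemma affine_comb h (I : finType) (P : pred I) (a : I -> R) (x : I -> V) :
  affine h -> \sum_(i | P i) a i = 1 ->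
  h (\sum_(i | P i) a i *: x i) = \sum_(i | P i) a i * h (x i).
Proof.
move=> hA a1; rewrite affine_sumE //.
under eq_bigr do rewrite mulrBr.
by rewrite sumrB -mulr_suml a1; ring.
Qed.

Lemma derive_sum_affine (I : finType) (P : pred I) (a : I -> R)
    (h : I -> V -> R) v p :
  (forall i, P i -> affine (h i)) ->
  'D_v (fun q => \sum_(i | P i) a i * h i q) p =
  \sum_(i | P i) a i * 'D_v (h i) p.
Proof.
move=> hA; rewrite derive_affine; last first.
  by apply: affine_sum => i Pi; apply/affineZ/hA.
rewrite -sumrB; apply: eq_bigr => i Pi.
by rewrite derive_affine; [ring|exact: hA].
Qed.

End Affine.

Section Barycentric.
Variables (R : realType) (n N : nat) (x : 'I_N.+1 -> 'rV[R]_n).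
Local Notation V := 'rV[R]_n.
Implicit Types (f g e : {set 'I_N.+1}) (p v : V) (i : 'I_N.+1).

(** The row (1, p) is affine in p and the coordinates are obtained from it by
    a linear map. *)
Lemma affine_lambda i (T : {set 'I_N.+1}) : affine (lambda x i T).
Proof.
move=> t v p; rewrite /lambda; case: ifP => _; last by rewrite subrr mulr0 addr0.
set k := inord _; set B := invmx _.
have E q : ((row_mx 1 q : 'rV_(1 + n)) *m B) 0 k =
    (usubmx (B : 'M[R]_(1 + n, n.+1)) 0 k) + (q *m dsubmx (B : 'M[R]_(1 + n, n.+1))) 0 k.
  rewrite -[X in X = _]/((row_mx 1 q *m (B : 'M[R]_(1 + n, n.+1))) 0 k).
  by rewrite -{1}(vsubmxK (B : 'M[R]_(1 + n, n.+1))) mul_row_col mxE mul1mx.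
by rewrite !E mulmxDl -scalemxAl mul0mx !mxE; ring.
Qed.

Variable T : {set 'I_N.+1}.
Hypotheses (T_card : #|T| = n.+1) (T_unit : bary_mx x T \in unitmx).

Lemma sum_cell (M : nmodType) (F : 'I_N.+1 -> M) :
  \sum_(k < n.+1) F (nth ord0 (enum T) k) = \sum_(i in T) F i.
Proof.
have sT : size (enum T) = n.+1 by rewrite -cardE.
have -> : \sum_(i in T) F i = \sum_(i <- enum T) F i by rewrite big_enum.
by rewrite [RHS](big_nth ord0) sT big_mkord.
Qed.

Lemma lambda_nth (k : 'I_n.+1) p : lambda x (nth ord0 (enum T) k) T p =
  ((row_mx 1 p : 'rV_(1 + n)) *m invmx (bary_mx x T)) 0 k.
Proof.
have kT : (k < size (enum T))%N by rewrite -cardE T_card.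
rewrite /lambda -mem_enum mem_nth // index_uniq ?enum_uniq //.
by rewrite inord_val.
Qed.

(** The matrix [bary_mx] sends coefficients indexed by the ordered vertices to
    their sum together with the combination of vertices that they define. Both
    existence and uniqueness of barycentric coordinates follow from it. *)
Lemma bary_mulmx (a : 'I_N.+1 -> R) :
  (\row_k a (nth ord0 (enum T) (nat_of_ord k))) *m bary_mx x T =
  row_mx (\sum_(i in T) a i)%:M (\sum_(i in T) a i *: x i).
Proof.
apply/rowP => j; rewrite [LHS]mxE.
under eq_bigr do rewrite !mxE.
rewrite [RHS]mxE; case: (@fintype.split 1 n j) => j'.
  rewrite ord1 !mxE mulr1n -sum_cell; apply: eq_bigr => k _.
  by rewrite mulr1.
rewrite -sum_cell summxE; apply: eq_bigr => k _.
by rewrite mxE.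
Qed.

Lemma lambda_rowE p :
  (\row_k lambda x (nth ord0 (enum T) (nat_of_ord k)) T p) =
  (row_mx 1 p : 'rV_(1 + n)) *m invmx (bary_mx x T).
Proof. by apply/rowP => k; rewrite mxE lambda_nth. Qed.

Lemma lambda_bary p : \sum_(i in T) lambda x i T p = 1 /\
  \sum_(i in T) lambda x i T p *: x i = p.
Proof.
have := bary_mulmx (fun i => lambda x i T p).
rewrite lambda_rowE mulmxKV // => /(@eq_row_mx _ 1 1 n)[E1 <-]; split=> //.
by move/matrixP/(_ 0 0): E1; rewrite !mxE.
Qed.

Lemma lambda_hull (a : 'I_N.+1 -> R) i : i \in T ->
  \sum_(i in T) a i = 1 -> lambda x i T (\sum_(i in T) a i *: x i) = a i.
Proof.
move=> iT a1; have := bary_mulmx a; rewrite a1 => E.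
have iT' : (index i (enum T) < n.+1)%N.
  by rewrite -T_card cardE index_mem mem_enum.
have := lambda_nth (Ordinal iT') (\sum_(i in T) a i *: x i).
by rewrite /= -E mulmxK // mxE /= nth_index ?mem_enum.
Qed.

Lemma hull_lambda p : hull x T p ->
  (forall i, 0 <= lambda x i T p) /\
  (forall g, \sum_(i in g) lambda x i T p <= 1).
Proof.
move=> [a [a0 aT a1 ->]].
have sumT (M : nmodType) (F : 'I_N.+1 -> M) :
    (forall i, i \notin T -> F i = 0) -> \sum_i F i = \sum_(i in T) F i.
  by move=> F0; rewrite (bigID (mem T)) /= [X in _ + X]big1 ?addr0.
rewrite sumT in a1; last exact: aT.
rewrite sumT => [|i iT]; last by rewrite aT // scale0r.
have E i : lambda x i T (\sum_(i in T) a i *: x i) = a i.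
  have [/lambda_hull->//|iT] := boolP (i \in T).
  by rewrite aT // /lambda (negbTE iT).
split=> [i|g]; first by rewrite E.
under eq_bigr do rewrite E.
rewrite -a1 (big_setID T) /= [X in _ + X]big1 => [|i]; last first.
  by rewrite inE => /andP[/aT->].
by rewrite addr0 [leRHS](big_setID g) /= finset.setIC lerDl sumr_ge0.
Qed.

Lemma hull_of_lambda p : (forall i, i \in T -> 0 <= lambda x i T p) ->
  hull x T p.
Proof.
move=> l0; have [l1 lp] := lambda_bary p.
exists (fun i => lambda x i T p); split.
- by move=> i; have [/l0//|iT] := boolP (i \in T); rewrite /lambda (negbTE iT).
- by move=> i iT; rewrite /lambda (negbTE iT).
- rewrite (bigID (mem T)) /= l1 big1 ?addr0 // => i iT.
  by rewrite /lambda (negbTE iT).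
- rewrite (bigID (mem T)) /= lp big1 ?addr0 // => i iT.
  by rewrite /lambda (negbTE iT) scale0r.
Qed.

Lemma vertex_hull i : i \in T -> hull x T (x i).
Proof.
move=> iT; exists (fun l => (l == i)%:R); split.
- by move=> l; rewrite ler0n.
- by move=> l lT; case: eqP => // E; rewrite E iT in lT.
- by rewrite (bigD1 i) //= eqxx big1 ?addr0 // => l /negbTE->.
- by rewrite (bigD1 i) //= eqxx scale1r big1 ?addr0 // => l /negbTE->; rewrite scale0r.
Qed.

(** A cell spans the whole space affinely, since its barycentric matrix is
    invertible. *)
Lemma affine_hull0 (h : V -> R) : affine h ->
  (forall p, hull x T p -> h p = 0) -> forall p, h p = 0.
Proof.
move=> hA h0 p; have [l1 lp] := lambda_bary p.
rewrite -lp affine_comb // big1 // => i iT.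
by rewrite h0 ?mulr0 //; exact: vertex_hull.
Qed.

End Barycentric.

(** * Ordered vertices *)

Section OrderedEnum.
Variable N : nat.
Implicit Types (e : {set 'I_N.+1}) (i : 'I_N.+1).

(** The position of a vertex is the length of the part of the ordered
    enumeration that precedes it; this is how the signs of the Whitney forms
    meet those of the exterior product. *)
Lemma enum_split e i : i \in e -> exists s1 s2,
  [/\ enum e = s1 ++ i :: s2, enum (e :\ i) = s1 ++ s2 & size s1 = pos e i].
Proof.
move=> ie; have iE : i \in enum e by rewrite mem_enum.
have Ee (A : {set 'I_N.+1}) : enum A = [seq l <- enum 'I_N.+1 | l \in A].
  by rewrite enumT.
have lt_e : pairwise (fun a b : 'I_N.+1 => (a < b)%N) (enum e).
  rewrite Ee; apply: (subseq_pairwise (filter_subseq _ _)).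
  by rewrite -(pairwise_map val ltn) val_enum_ord -(sorted_pairwise ltn_trans) iota_ltn_sorted.
have Ei : enum (e :\ i) = [seq l <- enum e | l != i].
  by rewrite !Ee -[RHS]filter_predI; apply: eq_filter => l; rewrite /= !inE.
have Epos : pos e i = size [seq l : 'I_N.+1 <- enum e | (l < i)%N].
  rewrite /pos cardE !Ee -[in RHS]filter_predI; congr size; apply: eq_filter => l.
  by rewrite /= !inE andbC.
have := enum_uniq e; move: Ei Epos lt_e.
case/splitPr: iE => s1 s2 -> -> lt_e uniq_e; exists s1, s2.
move: uniq_e; rewrite cat_uniq /= => /and3P[_ /norP[is1 _] /andP[is2 _]].
move: lt_e; rewrite pairwise_cat => /and3P[/allrelP lt12 _ /= /andP[/allP lti2 _]].
rewrite !filter_cat /= eqxx ltnn; split=> //.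
  by congr cat; apply/all_filterP/allP => l ls;
    [apply: contraNneq is1|apply: contraNneq is2] => <-.
rewrite size_cat [X in (_ + size X)%N](_ : _ = [::]); last first.
  apply/eqP; rewrite -(negbK (_ == _)) -has_filter; apply/hasPn => l /lti2 il.
  by rewrite -leqNgt ltnW.
rewrite addn0; congr size; apply/esym/all_filterP/allP => l ls.
by apply: lt12 => //; rewrite mem_head.
Qed.

(** The two signs with which the facet opposite to l enters [x_i, e] and e
    differ by -1 once x_i has been moved to the front of both. *)
Lemma pos_cone e i l : i \notin e -> l \in e ->
  odd (pos (i |: e) i + pos (i |: e) l + pos (i |: (e :\ l)) i) =
  ~~ odd (pos e l).
Proof.
move=> ie le; have il : i != l by apply: contraNneq ie => ->.
have posU a (A : {set 'I_N.+1}) b : a \notin A ->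
    pos (a |: A) b = ((a < b) + pos A b)%N.
  move=> aA; rewrite /pos; have [ab|ab] := boolP (a < b)%N.
    rewrite (_ : [set _ in _ | _] = a |: [set c in A | (c < b)%N]).
      by rewrite cardsU1 inE (negbTE aA).
    apply/setP => c; rewrite !inE; case: eqP => //= ->; by rewrite ab.
  apply: eq_card => c; rewrite !inE; case: eqP => //= ->.
  by rewrite (negbTE ab) (negbTE aA).
have [e' le' E] : exists2 e' : {set 'I_N.+1}, l \notin e' & e = l |: e'.
  by exists (e :\ l); rewrite ?finset.setD1K ?setD11 // !inE eqxx.
rewrite {le}E in ie *; rewrite finset.setU1K //.
have ie' : i \notin e' by apply: contra ie; exact: setU1r.
rewrite !(posU i _ _ ie) !(posU i _ _ ie') !(posU l _ _ le') !oddD !oddb.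
rewrite ltnn; case: (ltngtP i l) => [||E]; last by rewrite (val_inj E) eqxx in il.
  by rewrite ltnn => _ /=; case: (odd (pos e' i)); case: (odd (pos e' l)).
by rewrite ltnn => _ /=; case: (odd (pos e' i)); case: (odd (pos e' l)).
Qed.

End OrderedEnum.

(** * Whitney forms *)

Section Whitney.
Variables (R : realType) (n N : nat) (x : 'I_N.+1 -> 'rV[R]_n).
Variables (K : {set {set 'I_N.+1}}) (T : {set 'I_N.+1}).
Local Notation V := 'rV[R]_n.
Implicit Types (e f g : {set 'I_N.+1}) (i l : 'I_N.+1) (p q v : V).
Implicit Types (vs us : seq V) (s : seq 'I_N.+1).

Lemma size_drop_one (W : Type) (vs : seq W) k : (k < size vs)%N ->
  size (take k vs ++ drop k.+1 vs) = (size vs).-1.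
Proof. by move=> kvs; rewrite size_cat size_takel ?size_drop; lia. Qed.

Lemma oneform_dlambda i p : oneform (dlambda x i T p).
Proof.
move=> [|v [|w vs]] // _; rewrite /dlambda /extd; first by rewrite big_ord0.
rewrite big1 // => k _.
rewrite (_ : (fun y => _) = cst 0) ?derive_cst ?mulr0 //.
apply/funext => q; rewrite /unit_form /nilp size_drop_one //=.
by rewrite mulr0.
Qed.

Lemma dlambdaE i p v : dlambda x i T p [:: v] = lambda x i T v - lambda x i T 0.
Proof.
rewrite /dlambda /extd big_ord1 /= expr0 mul1r.
rewrite (_ : (fun y => _) = lambda x i T); last first.
  by apply/funext => q; rewrite /unit_form mulr1.
exact/derive_affine/affine_lambda.
Qed.

(** The differential of an affine function is constant, so every d lambda_i
    may be evaluated at the origin. *)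
Lemma dlambda_cst i p : dlambda x i T p = dlambda x i T 0.
Proof.
apply/funext => vs; have [|/[dup] s1] := eqVneq (size vs) 1%N; last first.
  by rewrite !oneform_dlambda.
by case: vs => [|v [|v' vs]] // _; rewrite 2!dlambdaE.
Qed.

Lemma dlambda_notin i p : i \notin T -> dlambda x i T p = fun=> 0.
Proof.
move=> iT; apply/funext => vs.
have [|/[dup] s1] := eqVneq (size vs) 1%N; last by rewrite !oneform_dlambda.
by case: vs => [|v []] // _; rewrite dlambdaE /lambda (negbTE iT) subrr.
Qed.

(** Only the coefficients are differentiated: d(h c) = dh /\ c for constant c. *)
Lemma extd_affine (I : finType) (P : pred I) (h : I -> V -> R)
    (c : I -> alt R V) (dh : I -> alt R V) p vs :
  (forall j, P j -> affine (h j)) -> (forall j, P j -> oneform (dh j)) ->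
  (forall j v, P j -> dh j [:: v] = h j v - h j 0) ->
  extd (fun q us => \sum_(j | P j) h j q * c j us) p vs =
  \sum_(j | P j) wedge (dh j) (c j) vs.
Proof.
move=> hA dh1 dhE; rewrite /extd.
under [RHS]eq_bigr => j Pj do rewrite (wedge1E 0 _ _ (dh1 j Pj)).
rewrite exchange_big /=; apply: eq_bigr => k _; rewrite -mulr_sumr; congr (_ * _).
rewrite derive_affine.
  by rewrite -sumrB; apply: eq_bigr => j Pj; rewrite dhE // mulrBl.
apply: affine_sum => j Pj; under eq_fun do rewrite mulrC.
exact/affineZ/hA.
Qed.

(** The differentials are taken at the origin, which loses nothing by
    [dlambda_cst] and makes the product a single constant form. *)
Definition dwedge s : alt R V :=
  \big[@wedge R V/@unit_form R V]_(l <- s) dlambda x l T 0.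

Lemma dwedge_cons l s : dwedge (l :: s) = wedge (dlambda x l T 0) (dwedge s).
Proof. by rewrite /dwedge big_cons. Qed.

Lemma dwedge_insert l s1 s2 vs : dwedge (s1 ++ l :: s2) vs =
  (-1) ^+ size s1 * wedge (dlambda x l T 0) (dwedge (s1 ++ s2)) vs.
Proof.
elim: s1 vs => [|a s1 IH] vs; first by rewrite /= dwedge_cons mul1r.
rewrite /= !dwedge_cons exprS mulN1r mulNr.
rewrite [in RHS](wedge1_anticomm _ _ (oneform_dlambda l 0) (oneform_dlambda a 0)).
rewrite mulrN opprK -wedgeZr; congr wedge; apply/funext => us; exact: IH.
Qed.

(** Moving d lambda_i from the front to its place in the ordered product costs
    one sign for each smaller vertex of e. *)
Lemma wedge_dwedge e i vs : i \in e ->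
  wedge (dlambda x i T 0) (dwedge (enum (e :\ i))) vs =
  (-1) ^+ pos e i * dwedge (enum e) vs.
Proof.
move=> /enum_split[s1 [s2 [-> -> <-]]].
by rewrite dwedge_insert mulrA -exprD -signr_odd oddD addbb mul1r.
Qed.

(** A repeated 1-form kills the product: by anticommutation the product is its
    own opposite. *)
Lemma wedge_dwedge0 e i vs : i \in e ->
  wedge (dlambda x i T 0) (dwedge (enum e)) vs = 0.
Proof.
move=> ie; set a := dlambda x i T 0.
have -> : dwedge (enum e) = fun us =>
    (-1) ^+ pos e i * wedge a (dwedge (enum (e :\ i))) us.
  apply/funext => us.
  by rewrite wedge_dwedge // mulrA -exprD -signr_odd oddD addbb mul1r.
rewrite wedgeZr; have a1 : oneform a by exact: oneform_dlambda.
have := wedge1_anticomm (dwedge (enum (e :\ i))) vs a1 a1.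
by move/eqP; rewrite -addr_eq0 -mulr2n mulrn_eq0 /= => /eqP->; rewrite mulr0.
Qed.

Lemma whitneyE e p vs : e \in K -> e != finset.set0 ->
  whitney x K e T p vs = \sum_(i in e) lambda x i T p *
    ((#|e|.-1)`!%:R * (-1) ^+ pos e i * dwedge (enum (e :\ i)) vs).
Proof.
move=> eK e0; rewrite /whitney eK (negbTE e0) /= mulr_sumr.
apply: eq_bigr => i ie; rewrite [X in _ * (_ * X _)](_ : _ = dwedge (enum (e :\ i))).
  by ring.
by apply: eq_bigr => l _; exact: dlambda_cst.
Qed.

Lemma whitney0 p : finset.set0 \in K -> whitney x K finset.set0 T p = @unit_form R V.
Proof. by move=> K0; rewrite /whitney K0 eqxx. Qed.

Lemma affine_whitney e vs : affine (fun q => whitney x K e T q vs).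
Proof.
have [eK|eK] := boolP (e \in K); last first.
  by rewrite /whitney eK; exact: affine_cst.
have [->|e0] := eqVneq e finset.set0.
  rewrite /whitney eqxx; case: ifP => _; exact: affine_cst.
under eq_fun do rewrite whitneyE //.
by apply: affine_sum => i ie; under eq_fun do rewrite mulrC;
  exact/affineZ/affine_lambda.
Qed.

(** Each of the #|e| terms of the Whitney form contributes the same ordered
    product, which turns the factor (#|e| - 1)! into #|e|!. *)
Lemma extd_whitney e p vs : e \in K -> e != finset.set0 ->
  extd (whitney x K e T) p vs = (#|e|)`!%:R * dwedge (enum e) vs.
Proof.
move=> eK e0.
have -> : whitney x K e T = fun q us => \sum_(i in e) lambda x i T q *
    ((#|e|.-1)`!%:R * (-1) ^+ pos e i * dwedge (enum (e :\ i)) us).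
  by apply/funext => q; apply/funext => us; rewrite whitneyE.
rewrite (@extd_affine _ _ _ _ (fun i => dlambda x i T 0)); first last.
- by move=> i v _; exact: dlambdaE.
- by move=> i _; exact: oneform_dlambda.
- by move=> i _; exact: affine_lambda.
under eq_bigr => i ie do rewrite wedgeZr wedge_dwedge // mulrA -[_ * _ * _ ^+ _]mulrA
   -exprD -signr_odd oddD addbb mulr1.
rewrite sumr_const -[LHS]mulr_natl mulrA -natrM.
by congr (_%:R * _); case: #|e| (card_gt0 e) e0 => [|c _ _]; [move=> <-|rewrite factS].
Qed.

(** The operator lambda_i d - c d lambda_i /\ on forms of degree c - 1. On
    Whitney forms it adds the vertex x_i in front ([cone_op_whitney]), and
    psi is a sum of such operators applied to mu. *)
Definition cone_op c i (a : pform R n N) : pform R n N := fun T p vs =>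
  lambda x i T p * extd_aug c a T p vs
  - c%:R * wedge (dlambda x i T p) (a T p) vs.

(** On a cell that misses a vertex l of e every term contains lambda_l or
    d lambda_l. *)
Lemma whitney_notin e p vs l : l \in e -> l \notin T ->
  whitney x K e T p vs = 0.
Proof.
move=> le lT; have e0 : e != finset.set0 by apply: contraTneq le => ->; rewrite inE.
have [eK|eK] := boolP (e \in K); last by rewrite /whitney eK.
rewrite whitneyE // big1 // => i ie.
have [->|il] := eqVneq i l; first by rewrite /lambda (negbTE lT) mul0r.
have lei : l \in e :\ i by rewrite !inE eq_sym il.
have -> : dwedge (enum (e :\ i)) vs = 0; last by rewrite !mulr0.
have := wedge_dwedge vs lei; rewrite dlambda_notin // wedge0l => /esym/eqP.
by rewrite mulf_eq0 signr_eq0 /= => /eqP.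
Qed.

(** A cone over e from one of its own vertices is degenerate. *)
Lemma cone_op_whitney_in e i p vs : e \in K -> i \in e ->
  cone_op #|e| i (whitney x K e) T p vs = 0.
Proof.
move=> eK ie; have e0 : e != finset.set0 by apply: contraTneq ie => ->; rewrite inE.
have e_gt0 : (0 < #|e|)%N by rewrite card_gt0.
rewrite /cone_op; have -> : extd_aug #|e| (whitney x K e) T p vs =
    extd (whitney x K e T) p vs by case: #|e| e_gt0.
rewrite extd_whitney //.
rewrite (_ : whitney x K e T p = fun us => \sum_(l in e) lambda x l T p *
    ((#|e|.-1)`!%:R * (-1) ^+ pos e l * dwedge (enum (e :\ l)) us)); last first.
  by apply/funext => us; rewrite whitneyE.
rewrite wedge_sumr (bigD1 i) //= [X in _ * (_ + X)]big1 => [|l /andP[le li]].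
  rewrite !wedgeZr dlambda_cst wedge_dwedge // addr0 -(prednK e_gt0) /=.
  rewrite factS natrM.
  rewrite -[_ * (-1) ^+ _ * (_ * _)]mulrA signrMK; ring.
by rewrite !wedgeZr dlambda_cst wedge_dwedge0 ?mulr0 // !inE eq_sym li.
Qed.

Lemma sign_sq k : (-1) ^+ k * (-1) ^+ k = 1 :> R.
Proof. by rewrite -expr2 sqrr_sign. Qed.

(** The cone formula. In the expansion of the right-hand side the term with
    lambda_i without differential gives lambda_i d phi_e, and the others give
    d lambda_i /\ phi_e, with the sign computed in [pos_cone]. *)
Lemma cone_op_whitney e i p vs : e \in K -> i \notin e -> i |: e \in K ->
  cone_op #|e| i (whitney x K e) T p vs =
  (-1) ^+ pos (i |: e) i * whitney x K (i |: e) T p vs.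
Proof.
move=> eK ie ieK.
have ie0 : i |: e != finset.set0 by apply/set0Pn; exists i; rewrite setU11.
rewrite [in RHS]whitneyE // big_setU1 //= finset.setU1K // cardsU1 ie /= mulrDr.
rewrite !mulrA -[_ * _ * _`!%:R]mulrAC.
have [e0|e0] := eqVneq e finset.set0.
  rewrite e0 /cone_op cards0 big_set0 mulr0 addr0 mul0r subr0 /=.
  rewrite whitney0 -?e0 // e0 fact0.
  rewrite /dwedge (_ : enum _ = [::]) ?big_nil; last by rewrite finset.enum_set0.
  by rewrite -[LHS]mul1r -[X in X * _ = _](sign_sq (pos (i |: finset.set0) i)); ring.
have e_gt0 : (0 < #|e|)%N by rewrite card_gt0.
rewrite /cone_op; have -> : extd_aug #|e| (whitney x K e) T p vs =
    extd (whitney x K e T) p vs by case: #|e| e_gt0.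
rewrite extd_whitney //; congr (_ + _).
  by rewrite -[LHS]mul1r -[X in X * _ = _](sign_sq (pos (i |: e) i)) add0n; ring.
rewrite (_ : whitney x K e T p = fun us => \sum_(l in e) lambda x l T p *
    ((#|e|.-1)`!%:R * (-1) ^+ pos e l * dwedge (enum (e :\ l)) us)); last first.
  by apply/funext => us; rewrite whitneyE.
rewrite wedge_sumr mulr_sumr -sumrN mulr_sumr; apply: eq_bigr => l le.
rewrite !wedgeZr dlambda_cst.
have il : i != l by apply: contraNneq ie => ->.
have -> : (i |: e) :\ l = i |: (e :\ l).
  by apply/setP => a; rewrite !inE; case: eqP => //= ->; rewrite eq_sym (negbTE il).
have -> : wedge (dlambda x i T 0) (dwedge (enum (e :\ l))) vs =
   (-1) ^+ pos (i |: (e :\ l)) i * dwedge (enum (i |: (e :\ l))) vs.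
  rewrite -wedge_dwedge ?setU11 // finset.setU1K //.
  by rewrite !inE negb_and ie orbT.
have -> : (#|e|)`!%:R = #|e|%:R * (#|e|.-1)`!%:R :> R.
  by rewrite -natrM -{1 2}(prednK e_gt0) factS.
have S : (-1) ^+ pos (i |: e) i * (-1) ^+ pos (i |: e) l =
    - ((-1) ^+ pos e l * (-1) ^+ pos (i |: e :\ l) i) :> R.
  have := congr1 (fun b : bool => (-1) ^+ b : R) (pos_cone ie le).
  rewrite signrN !oddD !signr_addb !signr_odd => E.
  by rewrite -[LHS]mulr1 -[X in _ * X = _](sign_sq (pos (i |: e :\ l) i)) mulrA E; ring.
set A := (-1) ^+ pos (i |: e) i in S *; set B := (-1) ^+ pos (i |: e) l in S *.
transitivity (- (A * B * - (lambda x l T p * (#|e|%:R * (#|e|.-1)`!%:R) *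
  dwedge (enum (i |: e :\ l)) vs))); last by ring.
  by rewrite S; ring.
Qed.

End Whitney.

(** * Coning off the Whitney forms *)

Section Quotient.
Variables (R : realType) (V : normedModType R).

Lemma derive_affine_div (h r : V -> R) c v p : affine h -> affine r ->
  r p != 0 ->
  'D_v (fun q => h q / r q ^+ c) p =
  (r p * 'D_v h p - c%:R * (h p * 'D_v r p)) / r p ^+ c.+1.
Proof.
move=> hA rA rp0.
have dh : derivable h p v by exact: derivable_affine.
have dr : derivable r p v by exact: derivable_affine.
have rcE : (r ^+ c) p = r p ^+ c by rewrite exprfctE.
have rc0 : (r ^+ c) p != 0 by rewrite rcE expf_neq0.
have drc : derivable (r ^+ c) p v by exact: derivableX.
have -> : (fun q => h q / r q ^+ c) = h * (fun q => ((r ^+ c) q)^-1).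
  by apply/funext => q; rewrite exprfctE.
rewrite (deriveM dh (derivableV rc0 drc)) (deriveV rc0 drc) (deriveX c dr) !rcE /GRing.scale /=.
by case: c {rcE rc0 drc} => [|c] /=; rewrite ?exprS ?expr0; field; rewrite ?expf_neq0 ?rp0.
Qed.

End Quotient.

Section Cone.
Variables (R : realType) (n N : nat) (x : 'I_N.+1 -> 'rV[R]_n).
Variables (K : {set {set 'I_N.+1}}) (T : {set 'I_N.+1}).
Hypotheses (T_card : #|T| = n.+1) (T_unit : bary_mx x T \in unitmx).
Local Notation V := 'rV[R]_n.
Implicit Types (e f g : {set 'I_N.+1}) (i l : 'I_N.+1) (p q v : V).
Implicit Types (vs us ws : seq V).

(** On a cell the barycentric coordinates add up to one. *)
Lemma rhoE g p : rho x g T p = \sum_(i in T :\: g) lambda x i T p.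
Proof.
rewrite /rho -(lambda_bary T_card T_unit p).1 (big_setID g) /=.
rewrite [X in _ - X](big_setID T) /= [X in _ - (_ + X)]big1 => [|i].
  by rewrite addr0 finset.setIC addrC addrK.
by rewrite !inE /lambda => /andP[/negbTE->].
Qed.

Lemma affine_rho g : affine (rho x g T).
Proof.
rewrite (_ : rho x g T = fun p => \sum_(i in T :\: g) lambda x i T p).
  by apply: affine_sum => i _; exact: affine_lambda.
by apply/funext => p; exact: rhoE.
Qed.

Lemma derive_rho g v p :
  'D_v (rho x g T) p = \sum_(i in T :\: g) dlambda x i T p [:: v].
Proof.
rewrite derive_affine; last exact: affine_rho.
by rewrite !rhoE -sumrB; apply: eq_bigr => i _; rewrite dlambdaE.
Qed.

(** The quotient rule for d, where d rho_g is the sum of the d lambda_i over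
    the vertices of the cell outside g. *)
Lemma extd_whitney_div e g c p vs : rho x g T p != 0 ->
  extd (fun q us => whitney x K e T q us / rho x g T q ^+ c.+1) p vs =
  (\sum_(i in T :\: g) cone_op x c.+1 i (whitney x K e) T p vs) /
  rho x g T p ^+ c.+2.
Proof.
move=> rp0; rewrite /cone_op sumrB -mulr_suml -rhoE -mulr_sumr.
have -> : \sum_(i in T :\: g) wedge (dlambda x i T p) (whitney x K e T p) vs =
    \sum_(k < size vs) (-1) ^+ k * ('D_(nth 0 vs k) (rho x g T) p *
      whitney x K e T p (take k vs ++ drop k.+1 vs)).
  under eq_bigr do rewrite (wedge1E 0 _ _ (oneform_dlambda _ _ _ _)).
  rewrite exchange_big /=; apply: eq_bigr => k _.
  by rewrite -mulr_sumr -mulr_suml derive_rho.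
rewrite /extd_aug /extd !mulr_sumr -sumrB mulr_suml; apply: eq_bigr => k _.
rewrite derive_affine_div //; [|exact: affine_whitney|exact: affine_rho].
ring.
Qed.

(** The cone operator acts on the first factor of a tensor identity. For
    c = 0 it does not differentiate and the identity on the cell suffices;
    for c > 0 the identity extends from the cell to the whole space because
    both sides are affine there, hence it may be differentiated even at the
    boundary of the cell. *)
Lemma cone_op_tensor (I J : finType) (P : pred I) (Q : pred J)
    (a : I -> pform R n N) (b : J -> pform R n N) (s : I -> R) (t : J -> R)
    c i p vs :
  hull x T p ->
  (forall q us, hull x T q ->
    \sum_(j | P j) a j T q us * s j = \sum_(j | Q j) b j T q us * t j) ->
  ((0 < c)%N -> forall j us, P j -> affine (fun q => a j T q us)) ->
  ((0 < c)%N -> forall j us, Q j -> affine (fun q => b j T q us)) ->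
  \sum_(j | P j) cone_op x c i (a j) T p vs * s j =
  \sum_(j | Q j) cone_op x c i (b j) T p vs * t j.
Proof.
move=> Tp E aA bA.
have split_op (A : finType) (S : pred A) (d : A -> pform R n N) (k : A -> R) :
    \sum_(j | S j) cone_op x c i (d j) T p vs * k j =
    lambda x i T p * (\sum_(j | S j) extd_aug c (d j) T p vs * k j)
    - c%:R * wedge (dlambda x i T p) (fun us => \sum_(j | S j) d j T p us * k j) vs.
  rewrite wedge_sumr !mulr_sumr -sumrB; apply: eq_bigr => j _.
  under [X in wedge _ X]eq_fun do rewrite mulrC.
  by rewrite wedgeZr /cone_op; ring.
rewrite !split_op; congr (_ * _ - _ * _); last first.
  by congr wedge; apply/funext => us; exact: E.
case: c aA bA {split_op} => [|c] aA bA; first exact: E.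
have ext (A : finType) (S : pred A) (d : A -> pform R n N) (k : A -> R) :
    (forall j us, S j -> affine (fun q => d j T q us)) ->
    \sum_(j | S j) extd_aug c.+1 (d j) T p vs * k j =
    extd (fun q us => \sum_(j | S j) d j T q us * k j) p vs.
  move=> dA; rewrite /extd_aug /extd.
  under eq_bigr do rewrite mulr_suml.
  rewrite exchange_big /=; apply: eq_bigr => k' _.
  under [X in 'D__ X _]eq_fun do under eq_bigr do rewrite mulrC.
  rewrite derive_sum_affine; last by move=> j Sj; exact: dA.
  by rewrite mulr_sumr; apply: eq_bigr => j _; ring.
rewrite !ext; [|by move=> j us; apply: bA|by move=> j us; apply: aA].
apply: (congr1 (fun b => extd b p vs)).
apply/funext => q; apply/funext => us; apply/eqP; rewrite -subr_eq0; apply/eqP.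
apply: (affine_hull0 T_card T_unit (h := fun q =>
  \sum_(j | P j) a j T q us * s j - \sum_(j | Q j) b j T q us * t j)).
  rewrite (_ : (fun _ => _) = fun q => \sum_(j | P j) s j * a j T q us +
      (-1) * \sum_(j | Q j) t j * b j T q us).
    apply: affineD; first by apply: affine_sum => j Pj; exact/affineZ/aA.
    by apply/affineZ/affine_sum => j Qj; exact/affineZ/bA.
  apply/funext => q'; rewrite mulN1r; congr (_ - _);
  by apply: eq_bigr => j _; rewrite mulrC.
by move=> q' Tq'; rewrite E ?subrr.
Qed.

End Cone.

(** * Lebesgue measure on euclidean space *)

Section Integrability.
Local Open Scope classical_set_scope.
Local Open Scope ring_scope.
Variables (R : realType) (n : nat).
Local Notation V := 'rV[R]_n.

(** An open set is the union of the boxes with rational centre and radius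
    contained in it, and there are countably many of them. *)
Lemma measurable_vec_open (O : set V) : open O ->
  measurable (@vec_of_tuple R n @^-1` O).
Proof.
move=> oO.
pose box (c : n.-tuple rat * rat) : set (n.-tuple (measurableTypeR R)) :=
  \bigcap_(i in [set: 'I_n])
    ((@tnth n (measurableTypeR R) ^~ i) @^-1` ball (ratr (tnth c.1 i) : R) (ratr c.2)).
pose D := [set c | box c `<=` @vec_of_tuple R n @^-1` O].
rewrite (_ : _ @^-1` O = \bigcup_(c in D) box c).
  rewrite bigcup_mkcond; apply: countable_bigcupT_measurable.
    exact: countableP.
  move=> c; case: ifP => _; last exact: measurable0.
  apply: fin_bigcap_measurable => [|i _]; first exact: finite_finset.
  rewrite -[X in measurable X]setTI; apply: measurable_tnth => //.
  apply: (@open_measurable R). exact: ball_open.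
apply/seteqP; split=> [t Ot|t [c Dc ct]]; last exact: Dc.
have : nbhs (vec_of_tuple t) O by exact: open_nbhs_nbhs.
move=> /nbhs_ballP[e /= e0 eO].
(* Radius below e / 2: the centre is within it of t, and every point of the
   box within it of the centre. *)
have [r /itvP re] : exists r : rat, ratr r \in `]0, e / 2[.
  by apply: rat_in_itvoo; rewrite divr_gt0.
have r0 : 0 < ratr r :> R by rewrite re.
have re2 : ratr r < e / 2 by rewrite re.
have cE (i : 'I_n) : exists q : rat, ball (ratr q : R) (ratr r) (tnth t i).
  have [q /itvP qt] : exists q, ratr q \in `]tnth t i, tnth t i + ratr r[.
    by apply: rat_in_itvoo; rewrite ltrDl.
  have q1 : tnth t i < ratr q by rewrite qt.
  have q2 : ratr q < tnth t i + ratr r by rewrite qt.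
  by exists q; rewrite /ball /= ltr_norml; apply/andP; split; lra.
have [c cP] := choice cE.
exists ([tuple c i | i < n], r); last first.
  by move=> i _ /=; rewrite tnth_mktuple; exact: cP.
move=> t' t'c; apply: eO; split=> // a i; rewrite ord1 !mxE.
have := t'c i I; rewrite /= tnth_mktuple; have := cP i.
rewrite /ball /= !ltr_norml => /andP[h1 h2] /andP[h3 h4].
by apply/andP; split; lra.
Qed.

Lemma measurable_vec_closed (A : set V) : closed A ->
  measurable (@vec_of_tuple R n @^-1` A).
Proof.
move=> Acl; rewrite -(setCK A); apply: measurableC.
exact: (measurable_vec_open (closed_openC Acl)).
Qed.

Lemma measurable_vec_continuous (h : V -> R) : continuous h ->
  measurable_fun setT (h \o @vec_of_tuple R n).
Proof.
move=> hc; apply: (measurability _ (RGenOpens.measurableE R)).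
move=> _ [_ [a [b ->] <-]]; rewrite setTI comp_preimage.
by apply: measurable_vec_open; move/continuousP: hc; apply; exact: interval_open.
Qed.

Lemma measurable_box m (A : 'I_m -> set (measurableTypeR R)) :
  (forall i, measurable (A i)) ->
  measurable [set t : m.-tuple (measurableTypeR R) | forall i, A i (tnth t i)].
Proof.
move=> mA; rewrite (_ : [set t | _] = \bigcap_(i in [set: 'I_m])
    ((@tnth m (measurableTypeR R) ^~ i) @^-1` A i)).
  apply: fin_bigcap_measurable => [|i _]; first exact: finite_finset.
  by rewrite -[X in measurable X]setTI; apply: measurable_tnth.
by apply/seteqP; split=> t tA i; [move=> _|]; exact: tA.
Qed.

Lemma lebesgue_tuple_cube_lty m (M : R) :
  (lebesgue_tuple R m [set t : m.-tuple (measurableTypeR R) |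
     forall i, `[(- M)%R, M]%classic (tnth t i)] < +oo)%E.
Proof.
have itv_lty : (lebesgue_measure `[(- M)%R, M]%classic < +oo)%E.
  by rewrite lebesgue_measure_itv /=; case: ifP => // _; rewrite -EFinB ltry.
elim: m => [|m IH].
  by rewrite /lebesgue_tuple /= diracE; case: (_ \in _); rewrite ltry.
rewrite /lebesgue_tuple /= /power_succ /pushforward.
rewrite (_ : _ @^-1` _ = `[- M, M]%classic `*`
    [set t : m.-tuple (measurableTypeR R) | forall i, `[- M, M]%classic (tnth t i)]).
  rewrite product_measure1E; [|exact: measurable_itv|]; last first.
    by apply: (@measurable_box m (fun=> `[- M, M]%classic)) => i; exact: measurable_itv.
  apply: lte_mul_pinfty => //.
    by rewrite ge0_fin_numE //; exact: itv_lty.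
apply/seteqP; split=> [[a t] /= H|[a t] /= [Ha Ht] i].
  split=> [|i]; first by have := H ord0; rewrite (tnth_nth 0).
  by have := H (lift ord0 i); rewrite !(tnth_nth 0).
(* A coordinate of the tuple a :: t is a itself or a coordinate of t. *)
have [j ->|->] := unliftP ord0 i; last by rewrite (tnth_nth 0).
by have := Ht j; rewrite !(tnth_nth 0).
Qed.

(** A closed bounded set is compact, so a continuous function is bounded on
    it, and it lies in a cube, so its measure is finite. *)
Lemma continuous_integrable (A : set V) (h : V -> R) :
  closed A -> bounded_set A -> continuous h ->
  (lebesgue_tuple R n).-integrable (@vec_of_tuple R n @^-1` A)
    (EFin \o (h \o @vec_of_tuple R n)).
Proof.
move=> Acl Abd hc.
have mA := measurable_vec_closed Acl.
apply: (@measurable_bounded_integrable _ _ _ (lebesgue_tuple R n) (h \o @vec_of_tuple R n)) => //.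
- have [M [_ AM]] := Abd.
  apply: le_lt_trans (lebesgue_tuple_cube_lty n (M + 1)).
  apply: le_measure; rewrite ?inE //.
    by apply: (@measurable_box n (fun=> `[- (M + 1), M + 1]%classic)) => i; exact: measurable_itv.
  move=> t At i; have : `|vec_of_tuple t| <= M + 1 by apply: AM => //; rewrite ltrDl.
  move=> /(le_trans _) tM; have : `|vec_of_tuple t 0 i| <= M + 1.
    apply: tM; rewrite [leRHS]/Num.Def.normr /= mx_normrE; apply/bigmax_geP; right => /=.
    by exists (0, i).
  by rewrite mxE /= in_itv /= ler_norml.
- apply: measurable_funS (measurable_vec_continuous hc) => //.
- have Acpt := bounded_closed_compact Abd Acl.
  have /compact_bounded[M [Mreal hM]] : compact (h @` A).
    by apply: continuous_compact => //; exact: continuous_subspaceT.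
  exists M; split=> // M' MM' t At; apply: hM => //.
  by exists (vec_of_tuple t).
Qed.

End Integrability.

(** * Functions continuous on a bounded closed set *)

Section ContinuousOn.
Local Open Scope classical_set_scope.
Local Open Scope ring_scope.
Variables (R : realType) (n : nat).
Local Notation V := 'rV[R]_n.
Implicit Types (A : set V) (h : V -> R).

(** A continuous extension is required, rather than continuity within A, so
    that measurability of the restriction is immediate. *)
Definition cont_on A h := exists2 H : V -> R, continuous H &
  forall y, A y -> h y = H y.

Lemma cont_on_cst A (c : R) : cont_on A (fun=> c).
Proof. by exists (fun=> c) => //; exact: cst_continuous. Qed.

Lemma cont_onD A h h' : cont_on A h -> cont_on A h' ->
  cont_on A (fun y => h y + h' y).
Proof.
move=> [H Hc HE] [H' Hc' HE']; exists (fun y => H y + H' y).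
  by move=> y; apply: continuousD; [exact: Hc|exact: Hc'].
by move=> y Ay; rewrite HE // HE'.
Qed.

Lemma cont_onM A h h' : cont_on A h -> cont_on A h' ->
  cont_on A (fun y => h y * h' y).
Proof.
move=> [H Hc HE] [H' Hc' HE']; exists (fun y => H y * H' y).
  by move=> y; apply: continuousM; [exact: Hc|exact: Hc'].
by move=> y Ay; rewrite HE // HE'.
Qed.

Lemma eq_cont_on A h h' : (forall y, A y -> h y = h' y) ->
  cont_on A h -> cont_on A h'.
Proof. by move=> E [H Hc HE]; exists H => // y Ay; rewrite -E // HE. Qed.

Lemma cont_on_sum A (I : Type) (r : seq I) (P : pred I) (h : I -> V -> R) :
  (forall i, P i -> cont_on A (h i)) ->
  cont_on A (fun y => \sum_(i <- r | P i) h i y).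
Proof.
move=> hc; elim: r => [|i r IH].
  apply: (@eq_cont_on _ (fun=> 0)) => [y _|]; last exact: cont_on_cst.
  by rewrite big_nil.
case: (boolP (P i)) => Pi.
  apply: (@eq_cont_on _ (fun y => h i y + \sum_(j <- r | P j) h j y)) => [y _|].
    by rewrite big_cons Pi.
  by apply: cont_onD => //; exact: hc.
apply: (eq_cont_on _ IH) => y _; by rewrite big_cons (negbTE Pi).
Qed.

Lemma affine_cont_on A h : affine h -> cont_on A h.
Proof.
move=> hA; apply: (@eq_cont_on _ (fun p => h 0 +
    \sum_j p 0 j * (h (delta_mx 0 j) - h 0))) => [p _|].
  by rewrite -(affine_sumE _ _ _ hA) -row_sum_delta.
apply: cont_onD; first exact: cont_on_cst.
apply: cont_on_sum => j _; apply: cont_onM; last exact: cont_on_cst.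
by exists (fun p => p 0 j) => //; exact: coord_continuous.
Qed.

Lemma affine_continuous h : affine h -> continuous h.
Proof.
move=> /(@affine_cont_on setT)[H Hc HE].
by rewrite (_ : h = H) //; apply/funext => y; exact: HE.
Qed.

Lemma cont_on_wedge (W : Type) A (a b : V -> alt R W) vs :
  (forall us, cont_on A (fun y => a y us)) ->
  (forall us, cont_on A (fun y => b y us)) ->
  cont_on A (fun y => wedge (a y) (b y) vs).
Proof.
elim: vs a b => [|v vs IH] a b ac bc /=; first exact: cont_onM.
apply: cont_onD; apply: IH => us //; apply: cont_onM => //.
exact: cont_on_cst.
Qed.

Lemma cont_on_integrable A h : closed A -> bounded_set A -> cont_on A h ->
  (lebesgue_tuple R n).-integrable (@vec_of_tuple R n @^-1` A)
    (EFin \o (h \o @vec_of_tuple R n)).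
Proof.
move=> Acl Abd [H Hc HE].
have mA := measurable_vec_closed Acl.
apply: (eq_integrable mA _ _ _ (continuous_integrable Acl Abd Hc)).
by move=> t /set_mem At /=; rewrite HE.
Qed.

Lemma integral_on_sum A (I : Type) (r : seq I) (P : pred I) (c : I -> R)
    (h : I -> V -> R) : closed A -> bounded_set A ->
  (forall i, P i -> cont_on A (h i)) ->
  integral_on A (fun y => \sum_(i <- r | P i) c i * h i y) =
  \sum_(i <- r | P i) c i * integral_on A (h i).
Proof.
move=> Acl Abd hc.
have mA := measurable_vec_closed Acl.
rewrite /integral_on; elim: r => [|i r IH].
  rewrite big_nil (@eq_Rintegral _ _ _ _ _ (fun=> 0)) => [|t _]; last by rewrite big_nil.
  by rewrite Rintegral_cst // mul0r.
rewrite big_cons; case: ifP => Pi; last first.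
  by rewrite -IH; apply: eq_Rintegral => t _; rewrite big_cons Pi.
rewrite -IH -RintegralZl //; last by apply: cont_on_integrable => //; exact: hc.
rewrite -RintegralD //.
- by apply: eq_Rintegral => t _; rewrite big_cons Pi.
- apply: (@cont_on_integrable _ (fun y => c i * h i y)) => //.
  by apply: cont_onM; [exact: cont_on_cst|exact: hc].
- apply: (@cont_on_integrable _
    (fun y => \sum_(j <- r | P j) c j * h j y)) => //.
  by apply: cont_on_sum => j Pj; apply: cont_onM; [exact: cont_on_cst|exact: hc].
Qed.

Lemma eq_integral_on A h h' : (forall y, A y -> h y = h' y) ->
  integral_on A h = integral_on A h'.
Proof. by move=> E; apply: eq_Rintegral => t /set_mem At; exact: E. Qed.

Lemma kform_sum (k : nat) (a : alt R V) (I : Type) (r : seq I)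
    (c : I -> R) (v : I -> V) us ws : is_kform k a ->
  a (us ++ (\sum_(i <- r) c i *: v i) :: ws) =
  \sum_(i <- r) c i * a (us ++ v i :: ws).
Proof.
move=> [_ aL _]; elim: r => [|i r IH]; last by rewrite !big_cons aL IH.
rewrite !big_nil; have := aL us ws 1 0 0.
by rewrite scale1r addr0 mul1r => /eqP; rewrite -subr_eq0 opprD addNKr oppr_eq0 => /eqP.
Qed.

(** Expand the first vector field in the standard basis and use linearity;
    the constant vectors obtained in this way accumulate in us. *)
Lemma cont_on_kform (k : nat) A (u : V -> alt R V) (G : V -> V) us
    (F : seq (V -> V)) :
  (forall p, A p -> is_kform k (u p)) ->
  (forall vs, exists2 h : V -> R, continuous h & forall p, A p -> u p vs = h p) ->
  continuous G -> (forall y, A y -> A (G y)) ->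
  (forall f, f \in F -> forall j, continuous (fun y => f y 0 j)) ->
  cont_on A (fun y => u (G y) (us ++ [seq f y | f <- F])).
Proof.
move=> uk uh Gc GA; elim: F us => [|f F IH] us Fc.
  have [h hc hE] := uh us; exists (h \o G); last by move=> y Ay; rewrite cats0 hE //; exact: GA.
  by move=> y; apply: continuous_comp; [exact: Gc|exact: hc].
apply: (eq_cont_on (h := fun y => \sum_j f y 0 j *
    u (G y) ((us ++ [:: delta_mx 0 j]) ++ [seq f y | f <- F]))).
  move=> y Ay; under eq_bigr do rewrite -catA /=.
  rewrite -(kform_sum _ _ _ _ _ (uk _ (GA _ Ay))) /=.
  by rewrite -row_sum_delta.
apply: cont_on_sum => j _; apply: cont_onM.
  by exists (fun y => f y 0 j) => //; apply: Fc; rewrite mem_head.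
by apply: IH => f' f'F; apply: Fc; rewrite inE f'F orbT.
Qed.

End ContinuousOn.

(** * Fiber integrals *)

Section FiberIntegrals.
Local Open Scope classical_set_scope.
Local Open Scope ring_scope.
Variables (R : realType) (n N : nat) (x : 'I_N.+1 -> 'rV[R]_n).
Local Notation V := 'rV[R]_n.
Local Notation W := 'rV[R]_N.+1.
Implicit Types (e f g T : {set 'I_N.+1}) (i : 'I_N.+1) (p y v : V) (l a : W).

Section Cell.
Variable T : {set 'I_N.+1}.
Hypotheses (T_card : #|T| = n.+1) (T_unit : bary_mx x T \in unitmx).

(** A cell is the intersection of the half-spaces where its barycentric
    coordinates are nonnegative. *)
Lemma closed_hull : closed (hull x T).
Proof.
have -> : hull x T = \bigcap_(i in [set i | i \in T])
    (lambda x i T @^-1` [set t | 0 <= t]).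
  apply/seteqP; split=> [p Tp i _ /=|p Tp].
    exact: (hull_lambda T_card T_unit Tp).1.
  by apply: (hull_of_lambda T_card T_unit) => i iT; exact: Tp.
apply: closed_bigI => i _; apply: closed_comp; last exact: closed_ge.
by move=> p _; apply: affine_continuous; exact: affine_lambda.
Qed.

Lemma bounded_hull : bounded_set (hull x T).
Proof.
exists (\sum_i `|x i|); split; first exact: num_real.
move=> M /ltW MM p [c [c0 _ c1 ->]]; apply: le_trans MM.
apply: le_trans (ler_norm_sum _ _ _) _; apply: ler_sum => i _.
rewrite normrZ ger0_norm // ler_piMl //.
by rewrite -c1 (bigD1 i) //= lerDl sumr_ge0.
Qed.

(** The point G_f(y, l) is a convex combination of y and the vertices of f. *)
Lemma Gmap_hull f l y : f \subset T -> (forall i, 0 <= l 0 i) ->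
  \sum_(i in f) l 0 i <= 1 -> hull x T y -> hull x T (Gmap x f (y, l)).
Proof.
move=> fT l0 l1 [c [c0 cT c1 ->]].
exists (fun i => (if i \in f then l 0 i else 0) + bS f l * c i); split.
- by move=> i; rewrite addr_ge0 ?mulr_ge0 ?subr_ge0 //; case: ifP.
- move=> i iT; rewrite cT // mulr0 addr0; case: ifP => // i_f.
  by rewrite (fintype.subsetP fT) in iT.
- by rewrite big_split /= -big_mkcond -mulr_sumr c1 mulr1 /bS; ring.
- rewrite /Gmap /= scaler_sumr big_mkcond -big_split /=.
  apply: eq_bigr => i _; rewrite [RHS]scalerDl scalerA; congr (_ + _).
  by case: ifP; rewrite ?scale0r.
Qed.

End Cell.

Lemma derive_Gmap1 f y l v :
  'D_(v, 0) (Gmap x f) ((y, l) : (V * W)%type) = bS f l *: v.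
Proof.
apply: (derive_line _).2 => t; rewrite /Gmap /= scaler0 add0r.
by rewrite scalerDr !scalerA (mulrC t) addrCA addrC.
Qed.

Lemma derive_Gmap2 f y l a : 'D_(0, a) (Gmap x f) ((y, l) : (V * W)%type) =
  \sum_(i in f) a 0 i *: x i - (\sum_(i in f) a 0 i) *: y.
Proof.
apply: (derive_line _).2 => t; rewrite /Gmap /= scaler0 add0r.
have -> : bS f (t *: a + l) = bS f l - t * \sum_(i in f) a 0 i.
  rewrite /bS mulr_sumr -addrA -opprD -big_split /=; congr (_ - _).
  by apply: eq_bigr => i _; rewrite !mxE addrC.
have -> : \sum_(i in f) (t *: a + l) 0 i *: x i =
    \sum_(i in f) l 0 i *: x i + t *: \sum_(i in f) a 0 i *: x i.
  rewrite scaler_sumr -big_split /=; apply: eq_bigr => i _.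
  by rewrite !mxE addrC scalerDl scalerA.
by rewrite scalerBl scalerBr scalerA addrACA.
Qed.

(** The images under the differential of G_f at (y, l) of the vectors (v, 0)
    and (0, a). *)
Definition Gvec f y l (b : V + W) : V :=
  match b with
  | inl v => bS f l *: v
  | inr a => \sum_(i in f) a 0 i *: x i - (\sum_(i in f) a 0 i) *: y
  end.

Lemma bicomp_pull_Gmap j f (u : V -> alt R V) y l vs ws :
  bicomp j (pull (Gmap x f) u (y, l)) vs ws =
  if size vs == j then
    u (Gmap x f (y, l)) [seq Gvec f y l b | b <- map inl vs ++ map inr ws]
  else 0.
Proof.
rewrite /bicomp /pull; case: ifP => // _; congr u.
rewrite !map_cat -!map_comp; congr (_ ++ _).
  by apply: eq_map => v /=; exact: derive_Gmap1.
by apply: eq_map => v /=; exact: derive_Gmap2.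
Qed.

Variables (K : {set {set 'I_N.+1}}) (k : nat) (u : pform R n N).
Hypothesis u_smooth : smooth_forms x K k u.
Hypothesis cell_unit : forall T, T \in simplices K n.+1 -> bary_mx x T \in unitmx.

Lemma card_cell T : T \in simplices K n.+1 -> #|T| = n.+1.
Proof. by rewrite inE => /andP[_ /eqP]. Qed.

(** The vectors at which G_f^* u is evaluated are affine in y, and G_f(., l)
    maps the cell to itself, where u is smooth. *)
Lemma cont_on_integrand T f l j (z : V -> alt R V) ws :
  T \in simplices K n.+1 -> f \subset T -> (forall i, 0 <= l 0 i) ->
  \sum_(i in f) l 0 i <= 1 -> (forall us, affine (fun y => z y us)) ->
  cont_on (hull x T) (fun y => wedge
    (fun vs => bicomp j (pull (Gmap x f) (u T) (y, l)) vs ws) (z y)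
    (std_basis R n)).
Proof.
move=> TK fT l0 l1 zA; have Tc := card_cell TK; have Tu := cell_unit TK.
have [uk uh] := u_smooth.1 T TK.
apply: cont_on_wedge => us; last exact: affine_cont_on.
apply: (@eq_cont_on _ _ _ (fun y => if size us == j then u T (Gmap x f (y, l))
    [seq Gvec f y l b | b <- map inl us ++ map inr ws] else 0)) => [y _|].
  by rewrite bicomp_pull_Gmap.
case: (size us == j); last exact: cont_on_cst.
pose F := [seq fun y => Gvec f y l b | b <- map inl us ++ map inr ws].
apply: (@eq_cont_on _ _ _ (fun y => u T (Gmap x f (y, l)) ([::] ++ [seq h y | h <- F]))).
  by move=> y _; rewrite /F -map_comp.
apply: (cont_on_kform (k := k)) => //.
- by move=> vs; have [h hC hE] := uh vs; exists h => //; exact: (hC 0%N).1.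
- move=> y; apply: (@continuousD _ _ _ (fun=> \sum_(i in f) l 0 i *: x i)
    (fun y => bS f l *: y)); first exact: cst_continuous.
  exact: scaler_continuous.
- by move=> y; exact: Gmap_hull.
- move=> h /mapP[b _ ->] c; apply: affine_continuous => t v p.
  by case: b => [v'|a] /=; rewrite !mxE; ring.
Qed.

(** The fiber integral is linear in z. The forms z_i must be affine on each
    cell, which makes the integrands integrable; z0 is only compared with
    their combination on the cells over which the integral runs. *)
Lemma fiber_int_sum (I : finType) (P : pred I) (c : I -> R)
    (z : I -> pform R n N) (z0 : pform R n N) j f l ws :
  (forall i, 0 <= l 0 i) -> \sum_(i in f) l 0 i <= 1 ->
  (forall h T us, P h -> T \in simplices K n.+1 -> affine (fun y => z h T y us)) ->
  (forall T y us, T \in simplices K n.+1 -> f \subset T -> hull x T y ->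
     z0 T y us = \sum_(h | P h) c h * z h T y us) ->
  fiber_int x K j f z0 u l ws = \sum_(h | P h) c h * fiber_int x K j f (z h) u l ws.
Proof.
move=> l0 l1 zA zE; rewrite /fiber_int; under [RHS]eq_bigr do rewrite mulr_sumr.
rewrite exchange_big /=; apply: eq_bigr => T /andP[TK fT].
rewrite -integral_on_sum.
- apply: eq_integral_on => y Ty.
  have -> : z0 T y = fun us => \sum_(h | P h) c h * z h T y us.
    by apply/funext => us; exact: zE.
  by rewrite wedge_sumr; apply: eq_bigr => h _; rewrite wedgeZr.
- exact: closed_hull (card_cell TK) (cell_unit TK).
- exact: bounded_hull.
- by move=> h Ph; apply: cont_on_integrand => // us; exact: zA.
Qed.

End FiberIntegrals.

(** * Reindexing over the links *)

Section Complex.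
Variables (N : nat) (K : {set {set 'I_N.+1}}).
Implicit Types (e f g : {set 'I_N.+1}) (i : 'I_N.+1).
Hypothesis K_sub : forall f g, f \in K -> g \subset f -> g \in K.

Lemma disjoint_memP e f : reflect (forall i, i \in e -> i \notin f) [disjoint e & f].
Proof. by rewrite disjoint_subset; exact: fintype.subsetP. Qed.

Lemma linkP f c e : reflect
  [/\ e \in K, #|e| = c, [disjoint e & f] & (e :|: f)%SET \in K]
  (e \in link K f c).
Proof.
by rewrite inE; apply: (iffP and4P) => [[-> /eqP-> -> ->]|[-> -> -> ->]].
Qed.

(** Moving a vertex i of the link simplex e to f is a bijection, with inverse
    (f, e, i) |-> (f - i, i + e). A face g of the smaller simplex is a face of
    the larger one that does not contain i. *)
Lemma reindex_link (M : nmodType) (m j : nat)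
    (F : {set 'I_N.+1} -> {set 'I_N.+1} -> {set 'I_N.+1} -> 'I_N.+1 -> M) :
  \sum_(f in simplices K m) \sum_(e in link K f j.+1)
    \sum_(g in powerset f) \sum_(i in e) F f e g i =
  \sum_(f in simplices K m.+1) \sum_(e in link K f j)
    \sum_(g in powerset f) \sum_(i in f :\: g) F (f :\ i) (i |: e) g i.
Proof.
rewrite !pair_big_dep /=.
pose h (a : {set 'I_N.+1} * {set 'I_N.+1} * {set 'I_N.+1} * 'I_N.+1) :=
  (a.1.1.1 :\ a.2, a.2 |: a.1.1.2, a.1.2, a.2).
pose h' (a : {set 'I_N.+1} * {set 'I_N.+1} * {set 'I_N.+1} * 'I_N.+1) :=
  (a.2 |: a.1.1.1, a.1.1.2 :\ a.2, a.1.2, a.2).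
rewrite (reindex_onto h h') /=; last first.
  move=> [[[f e] g] i] /= /andP[/andP[/andP[_ /linkP[_ _ dis _]] _] ie].
  rewrite /h /h' /= finset.setD1K // finset.setU1K //.
  by rewrite (disjointFr dis ie).
apply: eq_bigl => -[[[f e] g] i] /=; rewrite !powersetE.
rewrite /h' /h /= !xpair_eqE !eqxx !andbT.
apply/idP/idP.
  move=> /andP[/andP[/andP[/andP[fS /linkP[_ ec dis efK]] gf] _] /andP[/eqP fi /eqP ei]].
  have i_f : i \in f by rewrite -fi setU11.
  have ie : i \notin e by rewrite -ei !inE eqxx.
  have U : (i |: e) :|: (f :\ i) = e :|: f.
    by rewrite -[in RHS]fi finset.setUA [e :|: _]finset.setUC.
  rewrite U in efK; move: fS; rewrite inE => /andP[_ fc].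
  move: gf; rewrite subsetD1 => /andP[gf ig].
  rewrite gf !inE ig i_f !andbT.
  rewrite (K_sub efK (finset.subsetUr _ _)) (K_sub efK (finset.subsetUl _ _)) efK /= andbT.
  have {}ec : #|e| = j by move: ec; rewrite cardsU1 ie => -[].
  rewrite (cardsD1 i f) i_f (eqP fc) ec add1n !eqxx /=; apply/disjoint_memP => l le.
  have li : l != i by apply: contraNneq ie => <-.
  have := disjoint_memP _ _ dis l; rewrite !inE le orbT li /=; exact.
move=> /andP[/andP[/andP[fS /linkP[_ ec dis efK]] gf]].
rewrite inE => /andP[ig i_f].
have ie : i \notin e by rewrite (disjointFl dis i_f).
have U : (i |: e) :|: (f :\ i) = e :|: f.
  by rewrite -finset.setUA [_ :|: (_ :\ _)]finset.setUC finset.setUA finset.setD1K // finset.setUC.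
rewrite finset.setD1K // finset.setU1K // !eqxx !andbT subsetD1 gf ig setU11 !andbT.
move: fS; rewrite !inE U efK => /andP[fK fc].
have ieK : (i |: e)%SET \in K.
  by apply: K_sub efK _; rewrite finset.subUset finset.subsetUl finset.sub1set inE i_f orbT.
have fiK : (f :\ i)%SET \in K by apply: K_sub fK _; exact: subD1set.
have fic : #|f :\ i| == m by move: fc; rewrite (cardsD1 i) i_f.
rewrite ieK fiK fic cardsU1 ie ec eqxx /= andbT.
apply/disjoint_memP => l; rewrite !inE => /orP[/eqP->|le]; first by rewrite eqxx.
by rewrite (disjointFr dis le) andbF.
Qed.

End Complex.

(** * Restriction to faces *)

Section Pullback.
Variables (R : realType) (n N : nat) (x : 'I_N.+1 -> 'rV[R]_n).
Local Notation V := 'rV[R]_n.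
Local Notation W := 'rV[R]_N.+1.
Implicit Types (e f g T : {set 'I_N.+1}) (i : 'I_N.+1) (p v : V).

Lemma derive_Lmap g T p v :
  'D_v (Lmap x g T) p = Lmap x g T v - Lmap x g T 0.
Proof.
apply: (derive_line _).2 => t; apply/rowP => i; rewrite !mxE.
by case: ifP => _; [exact: affine_lambda|rewrite subrr mulr0 addr0].
Qed.

Section LmapSimplex.
Variable T : {set 'I_N.+1}.
Hypotheses (T_card : #|T| = n.+1) (T_unit : bary_mx x T \in unitmx).

Lemma Lmap_ge0 g p i : hull x T p -> 0 <= Lmap x g T p 0 i.
Proof.
by move=> Tp; rewrite mxE; case: ifP => // _; exact: (hull_lambda T_card T_unit Tp).1.
Qed.

Lemma sum_Lmap_le1 f g p : hull x T p -> \sum_(i in f) Lmap x g T p 0 i <= 1.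
Proof.
move=> Tp; rewrite (eq_bigr (fun i => if i \in g then lambda x i T p else 0)).
  rewrite -big_mkcondr /= (eq_bigl (mem (f :&: g)%SET)) => [|i].
    exact: (hull_lambda T_card T_unit Tp).2.
  by rewrite !inE.
by move=> i _; rewrite mxE.
Qed.

End LmapSimplex.

Lemma Lmap_out g T p v i : i \notin g ->
  Lmap x g T p 0 i = 0 /\ 'D_v (Lmap x g T) p 0 i = 0.
Proof. by move=> ig; rewrite derive_Lmap !mxE (negbTE ig) subrr. Qed.

Lemma bS_Lmap f g T p : g \subset f -> bS f (Lmap x g T p) = rho x g T p.
Proof.
move=> gf; rewrite /bS /rho (big_setID g) /= [X in _ - (_ + X)]big1 => [|i].
  rewrite addr0 (finset.setIidPr gf); congr (_ - _); apply: eq_bigr => i ig.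
  by rewrite mxE ig.
by rewrite inE mxE => /andP[/negbTE->].
Qed.

(** On a cell without the vertex x_i the function lambda_i is zero, so adding
    x_i to g changes neither L_g nor rho_g nor the sums of cones. *)
Lemma Lmap_setU1_notin i g T : i \notin T -> Lmap x (i |: g) T = Lmap x g T.
Proof.
move=> iT; apply/funext => p; apply/rowP => l; rewrite !mxE !inE.
by case: eqP => // -> /=; rewrite /lambda (negbTE iT) if_same.
Qed.

Lemma rho_setU1_notin i g T : i \notin T -> i \notin g -> rho x (i |: g) T = rho x g T.
Proof.
move=> iT ig; apply/funext => p.
by rewrite /rho big_setU1 //= {1}/lambda (negbTE iT) add0r.
Qed.

Lemma cone_op_notin c i (a : pform R n N) T p vs : i \notin T ->
  cone_op x c i a T p vs = 0.
Proof.
move=> iT; rewrite /cone_op {1}/lambda (negbTE iT) dlambda_notin //.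
by rewrite wedge0l mul0r mulr0 subrr.
Qed.

Lemma sum_cone_op_setU1_notin c i f g (a : pform R n N) T p vs :
  i \in f -> i \notin g -> i \notin T ->
  \sum_(l in (f :\: (i |: g))%SET) cone_op x c l a T p vs =
  \sum_(l in (f :\: g)%SET) cone_op x c l a T p vs.
Proof.
move=> i_f ig iT; rewrite [RHS](big_setD1 i) ?inE ?i_f ?ig //=.
rewrite cone_op_notin // add0r; apply: eq_bigl => l; rewrite !inE negb_or.
by rewrite andbA.
Qed.

(** The subsets with and without i are paired off with opposite signs. *)
Lemma altsum_invariant (M : pzRingType) (f : {set 'I_N.+1}) i
    (F : {set 'I_N.+1} -> M) : i \in f ->
  (forall g, g \subset f -> i \notin g -> F (i |: g) = F g) ->
  \sum_(g in powerset f) (-1) ^+ (#|f| - #|g|) * F g = 0.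
Proof.
move=> i_f E; rewrite (bigID (fun g : {set _} => i \in g)) /=.
rewrite (reindex_onto (fun g : {set _} => i |: g) (fun g => g :\ i)) /=; last first.
  by move=> g /andP[_ ig]; rewrite finset.setD1K.
rewrite [X in X + _](eq_bigl (fun g => (g \in powerset f) && (i \notin g))).
  rewrite -big_split big1 //= => g /andP[]; rewrite powersetE => gf ig.
  rewrite E // cardsU1 ig.
  have cgf : (#|g| < #|f|)%N.
    by apply/proper_card/properP; split=> //; exists i.
  have -> : (#|f| - #|g| = (#|f| - (1 + #|g|)).+1)%N by lia.
  by rewrite exprS mulN1r mulNr addrN.
move=> g; rewrite !powersetE finset.subUset finset.sub1set i_f setU11 andbT /=.
have [ig|ig] := boolP (i \in g); last by rewrite finset.setU1K ?eqxx ?andbT.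
rewrite andbF; apply/negbTE; rewrite negb_and; apply/orP; right.
by apply: contraTneq ig => <-; rewrite !inE eqxx.
Qed.

End Pullback.

Section Faces.
Variables (R : realType) (n N : nat) (x : 'I_N.+1 -> 'rV[R]_n).
Variables (K : {set {set 'I_N.+1}}).
Local Notation V := 'rV[R]_n.
Local Notation W := 'rV[R]_N.+1.
Implicit Types (e f g : {set 'I_N.+1}) (i : 'I_N.+1) (y v : V) (l a : W).
Hypothesis K_sub : forall f g, f \in K -> g \subset f -> g \in K.
Hypothesis cell_unit :
  forall T, T \in simplices K n.+1 -> bary_mx x T \in unitmx.
Variables (k : nat) (u : pform R n N).
Hypothesis u_smooth : smooth_forms x K k u.
Variables (w : {set 'I_N.+1} -> {set 'I_N.+1} -> pform R n N).
Hypothesis w_V : forall f e, f \in K -> f != finset.set0 -> e \in link K f #|e| ->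
  V_forms x K (n - #|e|) f (w e f).

Lemma affine_w e f T us : f \in K -> f != finset.set0 -> e \in link K f #|e| ->
  T \in simplices K n.+1 -> affine (fun y => w e f T y us).
Proof.
move=> fK f0 ef TK; have [[c cE] _ _] := w_V fK f0 ef.
under eq_fun do rewrite cE //.
by apply: affine_sum => e' _; apply: affineZ; exact: affine_whitney.
Qed.

(** Every weight that occurs in delta^+ is one of those that the axioms for
    weights constrain. *)
Lemma link_cone f e i : e \in link K f #|e| -> i \in e ->
  [/\ (i |: f)%SET \in K, (i |: f)%SET != finset.set0 &
      (e :\ i)%SET \in link K (i |: f) #|(e :\ i)%SET|].
Proof.
move=> /linkP[eK _ dis efK] ie; split.
- apply: K_sub efK _; rewrite finset.subUset finset.subsetUr finset.sub1set.
  by rewrite inE ie.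
- by apply/set0Pn; exists i; rewrite setU11.
apply/linkP; split=> //.
- by apply: K_sub eK _; exact: subD1set.
- apply/disjoint_memP => l; rewrite !inE => /andP[li le].
  by rewrite negb_or li (disjointFr dis le).
- by rewrite finset.setUA [(_ :\ _) :|: _]finset.setUC finset.setD1K.
Qed.

(** Where the coordinate of x_i vanishes, in the point l and in all the
    vectors, G_f and G_{<x_i, f>} have the same value and differential; the
    cells that contain f but not x_i contribute nothing as z vanishes there. *)
Lemma fiber_int_face j f i z l ws :
  (forall T y us, T \in simplices K n.+1 -> f \subset T -> i \notin T ->
     hull x T y -> z T y us = 0) ->
  i \notin f -> l 0 i = 0 -> (forall a, a \in ws -> a 0 i = 0) ->
  fiber_int x K j f z u l ws = fiber_int x K j (i |: f) z u l ws.
Proof.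
move=> z0 i_f li wsi; rewrite /fiber_int [LHS](bigID (fun T : {set _} => i \in T)) /=.
rewrite [X in _ + X]big1 => [|T /andP[/andP[TK fT] iT]]; last first.
  rewrite (@eq_integral_on _ _ _ _ (fun=> 0)) => [|y Ty].
    have Tcl := closed_hull (card_cell TK) (cell_unit TK).
    by rewrite /integral_on Rintegral_cst ?mul0r //; exact: measurable_vec_closed.
  rewrite (_ : z T y = fun=> 0) ?wedge0r //.
  by apply/funext => us; exact: z0.
rewrite addr0; apply: eq_big => [T|T _].
  by rewrite -andbA finset.subUset finset.sub1set [(i \in T) && _]andbC.
apply: eq_integral_on => y _.
apply: (congr1 (fun b => wedge b (z T y) (std_basis R n))); apply/funext => vs.
rewrite !bicomp_pull_Gmap; case: ifP => // _.
have bSE : bS (i |: f) l = bS f l by rewrite /bS big_setU1 //= li add0r.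
rewrite /Gmap /= bSE big_setU1 //= li scale0r add0r; congr u.
apply/eq_in_map => b; rewrite mem_cat => /orP[] /mapP[a aws ->] /=.
  by rewrite bSE.
by rewrite !big_setU1 //= wsi // scale0r !add0r.
Qed.

(** The map delta^+ is a sum over the vertices of e, and the weight
    w_{e - i, <x_i, f>} vanishes off the star of <x_i, f>, so each summand is
    the fiber integral Q of the larger simplex, restricted to a face. *)
Lemma Rop_split e f l ws : f \in K -> e \in link K f #|e| ->
  (forall i, 0 <= l 0 i) -> \sum_(i in f) l 0 i <= 1 ->
  (forall i, i \in e -> l 0 i = 0) ->
  (forall a, a \in ws -> forall i, i \in e -> a 0 i = 0) ->
  Rop x K w e f u l ws =
  \sum_(i in e) (-1) ^+ pos e i * Qop x K w (e :\ i) (i |: f) u l ws.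
Proof.
move=> fK ef l0 l1 le wse.
transitivity (\sum_(i in e) (-1) ^+ pos e i *
    fiber_int x K #|e|.-1 f (w (e :\ i)%SET (i |: f)%SET) u l ws).
  apply: (@fiber_int_sum _ _ _ _ _ _ _ u_smooth cell_unit _ (mem e)
    (fun i => (-1) ^+ pos e i) (fun i => w (e :\ i)%SET (i |: f)%SET)).
  - exact: l0.
  - exact: l1.
  - move=> i T us ie TK; have [ifK if0 eif] := link_cone ef ie.
    exact: affine_w.
  - by [].
apply: eq_bigr => i ie; have [ifK if0 eif] := link_cone ef ie.
have /linkP[_ _ dis _] := ef.
have -> : #|e|.-1 = #|(e :\ i)%SET| by rewrite (cardsD1 i e) ie.
rewrite (@fiber_int_face _ f i).
- by [].
- move=> T y us TK fT iT Ty; have [_ w0 _] := w_V ifK if0 eif.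
  by apply: w0 => //; rewrite finset.subUset finset.sub1set (negbTE iT).
- by rewrite (disjointFr dis ie).
- exact: le.
- by move=> a aws; exact: wse.
Qed.

End Faces.

(** * The identity on one cell *)

Section Identity.
Variables (R : realType) (n N : nat) (x : 'I_N.+1 -> 'rV[R]_n).
Variables (K : {set {set 'I_N.+1}}).
Local Notation V := 'rV[R]_n.
Local Notation W := 'rV[R]_N.+1.
Implicit Types (e f g : {set 'I_N.+1}) (i : 'I_N.+1) (y v : V) (l a : W).
Hypothesis K_sub : forall f g, f \in K -> g \subset f -> g \in K.
Hypothesis cell_unit :
  forall T, T \in simplices K n.+1 -> bary_mx x T \in unitmx.
Variables (k : nat) (u : pform R n N).
Hypothesis u_smooth : smooth_forms x K k u.
Variables (mu w : {set 'I_N.+1} -> {set 'I_N.+1} -> pform R n N).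
Hypothesis mu_span : forall f, f \in K -> (0 < #|f| <= n)%N ->
  forall j e, (j < n - #|f|)%N -> e \in link K f j.+2 ->
  whitney_span x K (link K f j.+1) (mu f e).
Hypothesis w_weights : is_weights x K mu w.
Variables (T : {set 'I_N.+1}) (p : V).
Hypotheses (T_cell : T \in simplices K n.+1) (T_p : hull x T p).

Let w_V f e : f \in K -> f != finset.set0 -> e \in link K f #|e| ->
  V_forms x K (n - #|e|) f (w e f).
Proof. by case: w_weights => H _ _ _; exact: H. Qed.

(** The sum of the Whitney forms of [x_i, e] over the vertices i of f outside
    g. *)
Definition cone_sum f g e : alt R V := fun us =>
  \sum_(i in (f :\: g)%SET) cone_op x #|e| i (whitney x K e) T p us.

(** The tensor identity for the weights, coned off in the first factor and
    integrated in the second. Both sides are the fiber integral of one and the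
    same form in the second variable. *)
Lemma sum_wedge_cone_sum f g c vs : f \in K -> (0 < #|f| <= n)%N ->
  f \subset T -> g \subset f -> (c <= n - #|f|)%N ->
  \sum_(e in link K f c)
    wedge (cone_sum f g e) (Lpull x g (Qop x K w e f u) T p) vs =
  \sum_(e in link K f c.+1)
    wedge (psi x f (mu f) e g T p) (Lpull x g (Rop x K w e f u) T p) vs.
Proof.
move=> fK fn fT gf cn; apply: wedge_tensor => us ws.
have Tc := card_cell T_cell; have Tu := cell_unit T_cell.
have f0 : f != finset.set0 by rewrite -card_gt0; case/andP: fn.
set l := Lmap x g T p.
have l0 i : 0 <= l 0 i by exact: Lmap_ge0.
have l1 : \sum_(i in f) l 0 i <= 1 by exact: sum_Lmap_le1.
have sE e d : e \in link K f d -> #|e| = d by case/linkP.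
(* The common value, as a form in the integration variable, of the two
   combinations that are integrated. *)
pose z0 : pform R n N := fun T' y ws' =>
  \sum_(e in link K f c) cone_sum f g e us * w e f T' y ws'.
set l' := [seq 'D_v (Lmap x g T) p | v <- ws].
have QE e : e \in link K f c -> Lpull x g (Qop x K w e f u) T p ws =
    fiber_int x K c f (w e f) u l l'.
  by move=> ef; rewrite /Lpull /pull /Qop (sE _ _ ef).
have RE e : e \in link K f c.+1 -> Lpull x g (Rop x K w e f u) T p ws =
    fiber_int x K c f (delta_plus w e f) u l l'.
  by move=> ef; rewrite /Lpull /pull /Rop (sE _ _ ef).
transitivity (fiber_int x K c f z0 u l l').
  rewrite (eq_bigr _ (fun e ef => congr1 _ (QE e ef))); apply/esym.
  apply: (@fiber_int_sum _ _ _ _ _ _ _ u_smooth cell_unit _ (mem (link K f c))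
    (fun e => cone_sum f g e us) (fun e => w e f) z0 c f l l' l0 l1).
    move=> e T' us' ef T'K; apply: (affine_w w_V) => //.
    by rewrite (sE _ _ ef).
  by [].
rewrite (eq_bigr _ (fun e ef => congr1 _ (RE e ef))).
apply: (@fiber_int_sum _ _ _ _ _ _ _ u_smooth cell_unit _ (mem (link K f c.+1))
  (fun e => psi x f (mu f) e g T p us) (fun e => delta_plus w e f) z0 c f l l' l0 l1).
  move=> e T' us' ef T'K; rewrite /delta_plus.
  have ef' : e \in link K f #|e| by rewrite (sE _ _ ef).
  apply: affine_sum => i ie; apply: affineZ.
  by have [ifK if0 eif] := link_cone K_sub ef' ie; exact: (affine_w w_V).
move=> T' y ws' T'K fT' T'y; rewrite /z0 /cone_sum.
have -> : \sum_(e in link K f c) (\sum_(i in (f :\: g)%SET)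
      cone_op x #|e| i (whitney x K e) T p us) * w e f T' y ws' =
    \sum_(i in (f :\: g)%SET) \sum_(e in link K f c)
      cone_op x c i (whitney x K e) T p us * w e f T' y ws'.
  rewrite exchange_big /=; apply: eq_bigr => e ef.
  by rewrite mulr_suml; apply: eq_bigr => i _; rewrite (sE _ _ ef).
have [_ _ tensor _] := w_weights.
transitivity (\sum_(i in (f :\: g)%SET) \sum_(e in link K f c.+1)
   cone_op x c i (mu f e) T p us * ((-1) ^+ c.+1 * delta_plus w e f T' y ws')).
  apply: eq_bigr => i _; apply: (cone_op_tensor Tc Tu i us T_p).
  - move=> q us' Tq; rewrite (tensor _ _ fK fn cn T q us' T' y ws') //.
    by rewrite mulr_sumr; apply: eq_bigr => e _; ring.
  - by move=> _ e us' _; exact: affine_whitney.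
  - move=> c_gt0 e us' ef; have cE := prednK c_gt0.
    have ef' : e \in link K f c.-1.+2 by rewrite cE.
    have jn : (c.-1 < n - #|f|)%N by rewrite cE.
    have [s sumE] := mu_span fK fn jn ef'.
    under eq_fun do rewrite sumE //.
    by apply: affine_sum => e' _; apply: affineZ; exact: affine_whitney.
rewrite exchange_big /=; apply: eq_bigr => e ef.
move: (delta_plus w e f T' y ws') => d.
rewrite /psi (sE _ _ ef) /= mulr_sumr mulr_suml; apply: eq_bigr => i _.
by rewrite /cone_op; ring.
Qed.

Lemma cone_op_eq0 c i (a : pform R n N) vs :
  (forall q us, a T q us = 0) -> cone_op x c i a T p vs = 0.
Proof.
move=> a0; have aE : a T = fun _ _ => 0.
  by apply/funext => q; apply/funext => us; exact: a0.
rewrite /cone_op aE wedge0r mulr0 subr0.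
case: c => [|c] /=; first by rewrite a0 mulr0.
rewrite aE /extd big1 ?mulr0 // => j _.
by rewrite derive_cst mulr0.
Qed.

(** If e is not a face of T, then phi_e is zero on T. Otherwise e and f
    together have all the vertices of T, so a vertex outside g belongs to e,
    where the cone vanishes, or to f outside g. *)
Lemma extd_whitney_top f g e us : f \in K -> f \subset T ->
  e \in link K f (n - #|f|).+1 -> rho x g T p != 0 -> (#|f| <= n)%N ->
  extd (fun q us => whitney x K e T q us / rho x g T q ^+ (n - #|f|).+1) p us =
  cone_sum f g e us / rho x g T p ^+ (n - #|f|).+2.
Proof.
move=> fK fT ef rho0 fn; have /linkP[eK ec dis efK] := ef.
rewrite extd_whitney_div; [|exact: card_cell T_cell|exact: cell_unit|exact: rho0].
congr (_ / _); rewrite /cone_sum ec.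
have [eT|/fintype.subsetPn[i ie iT]] := boolP (e \subset T); last first.
  rewrite !big1 // => l _; rewrite cone_op_eq0 // => q us';
    exact: whitney_notin ie iT.
rewrite (bigID (mem f)) /= [X in _ + X]big1 => [|i /andP[]]; last first.
  rewrite inE => /andP[_ iT] i_f.
  rewrite -ec; apply: cone_op_whitney_in => //.
  have : i \in e :|: f.
    suff -> : e :|: f = T by [].
    apply/eqP; rewrite eqEcard finset.subUset eT fT (card_cell T_cell) /=.
    by rewrite cardsU disjoint_setI0 // cards0 subn0 ec addSn subnK.
  by rewrite inE (negbTE i_f) orbF.
rewrite addr0; apply: eq_bigl => i; rewrite !inE.
have [i_f|//] := boolP (i \in f); last by rewrite !andbF.
by rewrite (fintype.subsetP fT _ i_f) !andbT.
Qed.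

(** The contribution of (f, g) to the second sum of C_{m-1}, once vertices have
    been moved from e to f. The index j counts the vertices of e. *)
Definition cone_part J f g vs := \sum_(j < J) (-1) ^+ j / rho x g T p ^+ j.+1 *
  \sum_(e in link K f j) wedge (cone_sum f g e) (Lpull x g (Qop x K w e f u) T p) vs.

(** The part of K_{m,f,g} that remains after the terms in A_f and phi_e have
    been split off. *)
Definition K_rest m f g vs :=
  \sum_(j < (n - m).+1) (-1) ^+ j.+1 / rho x g T p ^+ j.+1 *
    \sum_(e in link K f j.+1)
      wedge (psi x f (mu f) e g T p) (Lpull x g (Rop x K w e f u) T p) vs +
  (-1) ^+ (n - m) * \sum_(e in link K f (n - m).+1)
    wedge (extd (fun q us => whitney x K e T q us / rho x g T q ^+ (n - m).+1) p)
      (Lpull x g (Qop x K w e f u) T p) vs.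

Lemma Kfg_split m f g vs : Kfg x K mu w m f g u T p vs =
  - Lpull x g (Aop x K f u) T p vs +
  \sum_(j < (n - m).+1) (-1) ^+ j.+1 / rho x g T p ^+ j.+1 *
    \sum_(e in link K f j.+1)
      wedge (whitney x K e T p) (Lpull x g (Rop x K w e f u) T p) vs +
  K_rest m f g vs.
Proof.
rewrite /Kfg /K_rest addrA; congr (_ + _); rewrite -addrA; congr (_ + _).
rewrite -big_split /=; apply: eq_bigr => j _; rewrite -mulrDr; congr (_ * _).
by rewrite -big_split /=; apply: eq_bigr => e _; rewrite wedgeDl.
Qed.

(** The terms correspond one by one, the last one on the right being the one
    in the top dimension of the link. *)
Lemma K_rest_sub m f g vs : f \in K -> #|f| = m -> (0 < m <= n)%N ->
  f \subset T -> g \subset f -> rho x g T p != 0 ->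
  K_rest m f g vs = - cone_part (n - m).+2 f g vs.
Proof.
move=> fK fm mn fT gf rho0; rewrite /cone_part big_ord_recr /= opprD -sumrN.
congr (_ + _).
  apply: eq_bigr => j _; have jn : (j <= n - #|f|)%N by rewrite fm -ltnS.
  rewrite (sum_wedge_cone_sum vs fK _ fT gf jn) ?fm //.
  by rewrite exprS mulN1r !mulNr.
rewrite [in RHS]exprS mulN1r !mulNr opprK -[RHS]mulrA; congr (_ * _).
rewrite mulr_sumr; apply: eq_bigr => e ef; rewrite -wedgeZl.
apply: (congr1 (fun b => wedge b _ vs)).
apply/funext => us; rewrite -fm in ef *; rewrite extd_whitney_top //.
  by rewrite mulrC.
by rewrite fm; case/andP: mn.
Qed.

Lemma Lpull_setU1_notin i g (r : W -> alt R W) : i \notin T ->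
  Lpull x (i |: g)%SET r T = Lpull x g r T.
Proof. by move=> iT; rewrite /Lpull Lmap_setU1_notin. Qed.

Lemma cone_part_setU1_notin J f g i vs : i \in f -> i \notin g -> i \notin T ->
  cone_part J f (i |: g)%SET vs = cone_part J f g vs.
Proof.
move=> i_f ig iT; rewrite /cone_part (rho_setU1_notin x iT ig).
apply: eq_bigr => j _; apply: (congr1 ( *%R _)); apply: eq_bigr => e _.
have -> : cone_sum f (i |: g)%SET e = cone_sum f g e.
  by apply/funext => us; exact: sum_cone_op_setU1_notin.
by rewrite (Lpull_setU1_notin _ _ iT).
Qed.

Lemma K_rest_setU1_notin m f g i vs : i \in f -> i \notin g -> i \notin T ->
  K_rest m f (i |: g)%SET vs = K_rest m f g vs.
Proof.
move=> i_f ig iT; rewrite /K_rest (rho_setU1_notin x iT ig).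
under [X in _ + _ * X = _]eq_bigr do rewrite (Lpull_setU1_notin _ _ iT).
apply: (congr1 (+%R^~ _)).
apply: eq_bigr => j _; apply: (congr1 ( *%R _)); apply: eq_bigr => e _.
have -> : psi x f (mu f) e (i |: g)%SET T p = psi x f (mu f) e g T p.
  apply/funext => us; rewrite /psi /=; congr (_ * _).
  exact: (@sum_cone_op_setU1_notin _ _ _ _ #|e|.-1 i f g (mu f e)).
by rewrite (Lpull_setU1_notin _ _ iT).
Qed.

(** On a cell that does not contain f the forms themselves need not agree, but
    both alternating sums vanish. *)
Lemma altsum_K_rest m f vs : f \in simplices K m -> (0 < m <= n)%N ->
  (forall g, g \in K -> (#|g| <= m)%N -> rho x g T p != 0) ->
  \sum_(g in powerset f) (-1) ^+ (#|f| - #|g|) * K_rest m f g vs =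
  - \sum_(g in powerset f) (-1) ^+ (#|f| - #|g|) * cone_part (n - m).+2 f g vs.
Proof.
rewrite inE => /andP[fK /eqP fm] mn rho0.
have [fT|/fintype.subsetPn[i i_f iT]] := boolP (f \subset T); last first.
  transitivity (0 : R).
    apply: (altsum_invariant i_f) => g _ ig; exact: K_rest_setU1_notin i_f ig iT.
  apply/esym/eqP; rewrite oppr_eq0; apply/eqP.
  apply: (altsum_invariant i_f) => g _ ig; exact: cone_part_setU1_notin i_f ig iT.
rewrite -sumrN; apply: eq_bigr => g; rewrite powersetE => gf.
have rhog : rho x g T p != 0.
  apply: rho0; first exact: K_sub fK gf.
  by rewrite -fm; exact: subset_leq_card.
by rewrite (K_rest_sub vs fK fm mn fT gf rhog) mulrN.
Qed.

Lemma wedge_Rop_scale f g e j vs : g \subset f ->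
  wedge (fun us => whitney x K e T p us / rho x g T p)
    (Lpull x g (fun l ws => bS f l ^- j * Rop x K w e f u l ws) T p) vs =
  (rho x g T p ^+ j.+1)^-1 *
    wedge (whitney x K e T p) (Lpull x g (Rop x K w e f u) T p) vs.
Proof.
move=> gf.
have -> : Lpull x g (fun l ws => bS f l ^- j * Rop x K w e f u l ws) T p =
    fun us => rho x g T p ^- j * Lpull x g (Rop x K w e f u) T p us.
  by apply/funext => us; rewrite /Lpull /pull bS_Lmap.
under [X in wedge X]eq_fun do rewrite mulrC.
by rewrite wedgeZl wedgeZr mulrA exprS invfM.
Qed.

Lemma wedge_Rop_split f g e j vs : f \in K -> g \subset f ->
  e \in link K f j.+1 ->
  wedge (fun us => whitney x K e T p us / rho x g T p)
    (Lpull x g (fun l ws => bS f l ^- j * Rop x K w e f u l ws) T p) vs =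
  \sum_(i in e) (-1) ^+ pos e i / rho x g T p ^+ j.+1 *
    wedge (whitney x K e T p)
      (Lpull x g (Qop x K w (e :\ i)%SET (i |: f)%SET u) T p) vs.
Proof.
move=> fK gf ef; have /linkP[_ ec dis _] := ef.
have Tc := card_cell T_cell; have Tu := cell_unit T_cell.
have eg i : i \in e -> i \notin g.
  by move=> ie; apply: contra (disjoint_memP _ _ dis i ie); exact: fintype.subsetP.
rewrite wedge_Rop_scale //.
have -> : Lpull x g (Rop x K w e f u) T p = fun us => \sum_(i in e)
    (-1) ^+ pos e i * Lpull x g (Qop x K w (e :\ i)%SET (i |: f)%SET u) T p us.
  apply/funext => us; rewrite /Lpull /pull.
  rewrite (Rop_split K_sub cell_unit u_smooth w_V) //.
  - by rewrite ec.
  - by move=> i; exact: Lmap_ge0.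
  - exact: sum_Lmap_le1.
  - by move=> i /eg ig; exact: (Lmap_out x T p 0 ig).1.
  - by move=> a /mapP[v _ ->] i /eg ig; exact: (Lmap_out x T p v ig).2.
rewrite wedge_sumr mulr_sumr; apply: eq_bigr => i _.
by rewrite wedgeZr mulrA [_^-1 * _]mulrC.
Qed.

(** The removal of x_i from f changes the parity of #|f| - #|g|, which
    accounts for the passage from (-1)^(j+1) to (-1)^j. *)
Lemma Cop_cone_part m J vs :
  \sum_(j < J) \sum_(f in simplices K m) \sum_(e in link K f j.+1)
    (-1) ^+ j.+1 * altsum f (fun g T p =>
      wedge (fun us => whitney x K e T p us / rho x g T p)
        (Lpull x g (fun l ws => bS f l ^- j * Rop x K w e f u l ws) T p)) T p vs =
  \sum_(f in simplices K m.+1) \sum_(g in powerset f)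
    (-1) ^+ (#|f| - #|g|) * cone_part J f g vs.
Proof.
transitivity (\sum_(j < J) \sum_(f in simplices K m.+1) \sum_(g in powerset f)
    (-1) ^+ (#|f| - #|g|) * ((-1) ^+ j / rho x g T p ^+ j.+1 *
  \sum_(e in link K f j) wedge (cone_sum f g e) (Lpull x g (Qop x K w e f u) T p) vs)).
  apply: eq_bigr => j _.
  transitivity (\sum_(f in simplices K m) \sum_(e in link K f j.+1)
    \sum_(g in powerset f) \sum_(i in e)
     ((-1) ^+ j.+1 * (-1) ^+ (#|f| - #|g|) * ((-1) ^+ pos e i / rho x g T p ^+ j.+1 *
      wedge (whitney x K e T p)
      (Lpull x g (Qop x K w (e :\ i)%SET (i |: f)%SET u) T p) vs))).
    apply: eq_bigr => f; rewrite inE => /andP[fK _]; apply: eq_bigr => e ef.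
    rewrite /altsum mulr_sumr; apply: eq_bigr => g; rewrite powersetE => gf.
    by rewrite wedge_Rop_split // mulrA mulr_sumr.
  rewrite (reindex_link K_sub m j (fun f e g i =>
    ((-1) ^+ j.+1 * (-1) ^+ (#|f| - #|g|) * ((-1) ^+ pos e i / rho x g T p ^+ j.+1 *
      wedge (whitney x K e T p)
      (Lpull x g (Qop x K w (e :\ i)%SET (i |: f)%SET u) T p) vs)))).
  apply: eq_bigr => f _; rewrite exchange_big /=; apply: eq_bigr => g.
  rewrite powersetE => gf; rewrite !mulr_sumr; apply: eq_bigr => e ef.
  have /linkP[eK ec dis efK] := ef.
  rewrite /cone_sum wedge_suml !mulr_sumr; apply: eq_bigr => i.
  rewrite inE => /andP[ig i_f].
  have ie : i \notin e by rewrite (disjointFl dis i_f).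
  have ieK : (i |: e)%SET \in K.
    by apply: K_sub efK _; rewrite finset.subUset finset.subsetUl finset.sub1set inE i_f orbT.
  rewrite finset.setU1K // finset.setD1K //.
  (* The vertex i is outside e, so that its cone is a Whitney form up to the
     sign that brings i to the front. *)
  rewrite (_ : (fun us => cone_op _ _ _ _ _ _ us) = fun us =>
      (-1) ^+ pos (i |: e)%SET i * whitney x K (i |: e)%SET T p us); last first.
    by apply/funext => us; exact: cone_op_whitney.
  rewrite wedgeZl.
  have cgf : (#|g| < #|f|)%N by apply/proper_card/properP; split=> //; exists i.
  have -> : (#|f| - #|g| = (#|f :\ i| - #|g|).+1)%N.
    by move: cgf; rewrite (cardsD1 i f) i_f add1n ltnS => cgf; rewrite subSn.
  by rewrite !exprS; ring.
rewrite exchange_big /=; apply: eq_bigr => f _.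
by rewrite exchange_big /=; apply: eq_bigr => g _; rewrite -mulr_sumr.
Qed.

End Identity.

(** * The difference of consecutive operators *)

Theorem proposition7p3 (R : realType) (n N : nat) (Omega : set 'rV[R]_n)
  (x : 'I_N.+1 -> 'rV[R]_n) (K : {set {set 'I_N.+1}})
  (Omega_lip : lipschitz_domain Omega) (x_mesh : is_mesh x K Omega)
  (m k : nat) (m_gt0 : (1 <= m)%N) (m_le : (m <= n.-1)%N) (k_le : (k <= n)%N)
  (mu : {set 'I_N.+1} -> {set 'I_N.+1} -> pform R n N)
  (mu_def : forall f, f \in K -> (0 < #|f| <= n)%N ->
     is_mu x K Omega f (mu f))
  (w : {set 'I_N.+1} -> {set 'I_N.+1} -> pform R n N)
  (w_def : is_weights x K mu w)
  (u : pform R n N) (u_smooth : smooth_forms x K k u)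
  (T : {set 'I_N.+1}) (p : 'rV[R]_n) (vs : k.-tuple 'rV[R]_n) :
  T \in simplices K n.+1 -> hull x T p ->
  (forall g, g \in K -> (#|g| <= m)%N -> rho x g T p != 0) ->
  Cop x K w m u T p vs - Cop x K w m.-1 u T p vs =
  \sum_(f in simplices K m.+1) Kop x K mu w m f u T p vs +
  \sum_(f in simplices K m) Kop x K mu w m f u T p vs.
Proof.
move=> T_cell T_p rho0.
have [[_ _ K_sub] _ cell_unit _ _] := x_mesh.
have mu_span f : f \in K -> (0 < #|f| <= n)%N ->
    forall j e, (j < n - #|f|)%N -> e \in link K f j.+2 ->
    whitney_span x K (link K f j.+1) (mu f e).
  by move=> fK fn; have [_ sp _ _ _] := mu_def f fK fn.
have n_gt0 : (0 < n)%N.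
  by rewrite lt0n; apply: contraTneq (leq_trans m_gt0 m_le) => ->.
have m_n : (m < n)%N by rewrite -(prednK n_gt0) ltnS.
have mn : (0 < m <= n)%N by rewrite m_gt0 ltnW.
pose A c := \sum_(f in simplices K c) altsum f (fun g => Lpull x g (Aop x K f u)) T p vs.
pose P := \sum_(j < (n - m).+1) \sum_(f in simplices K m) \sum_(e in link K f j.+1)
    (-1) ^+ j.+1 * altsum f (fun g T p =>
      wedge (fun us => whitney x K e T p us / rho x g T p)
        (Lpull x g (fun l ws => bS f l ^- j * Rop x K w e f u l ws) T p)) T p vs.
have CmE : Cop x K w m u T p vs = A m.+1 + P by [].
(* As m - 1 >= 0, the range j <= n - (m - 1) has n - m + 2 elements. *)
have Cm1E : Cop x K w m.-1 u T p vs = A m +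
    \sum_(f in simplices K m) \sum_(g in powerset f)
      (-1) ^+ (#|f| - #|g|) * cone_part x K u w T p (n - m).+2 f g vs.
  have E : (n - m.-1).+1 = (n - m).+2 by rewrite -subSS (prednK m_gt0) subSn // ltnW.
  rewrite -E; have := Cop_cone_part K_sub cell_unit u_smooth w_def T_cell T_p m.-1 (n - m.-1).+1 vs.
  by rewrite (prednK m_gt0) => <-; rewrite -[X in A X](prednK m_gt0).
have K1E : \sum_(f in simplices K m.+1) Kop x K mu w m f u T p vs = A m.+1.
  apply: eq_bigr => f; rewrite inE => /andP[_ fm].
  by rewrite /Kop fm.
(* The terms with phi_e in K_{m,f} make up the second sum of C_m. *)
have K2E : \sum_(f in simplices K m) Kop x K mu w m f u T p vs = - A m + P
    - \sum_(f in simplices K m) \sum_(g in powerset f)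
      (-1) ^+ (#|f| - #|g|) * cone_part x K u w T p (n - m).+2 f g vs.
  have PE : P = \sum_(f in simplices K m) \sum_(g in powerset f)
      (-1) ^+ (#|f| - #|g|) * \sum_(j < (n - m).+1)
        (-1) ^+ j.+1 / rho x g T p ^+ j.+1 * \sum_(e in link K f j.+1)
          wedge (whitney x K e T p) (Lpull x g (Rop x K w e f u) T p) vs.
    rewrite /P exchange_big; apply: eq_bigr => f fm /=.
    transitivity (\sum_(j < (n - m).+1) \sum_(g in powerset f)
        (-1) ^+ (#|f| - #|g|) *
        ((-1) ^+ j.+1 / rho x g T p ^+ j.+1 * \sum_(e in link K f j.+1)
          wedge (whitney x K e T p) (Lpull x g (Rop x K w e f u) T p) vs)).
      apply: eq_bigr => j _; rewrite -mulr_sumr /altsum exchange_big mulr_sumr /=.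
      apply: eq_bigr => g; rewrite powersetE => gf; rewrite -mulr_sumr.
      rewrite mulrCA -mulrA; apply: (congr1 ( *%R _)).
      rewrite !mulr_sumr; apply: eq_bigr => e _.
      by rewrite (wedge_Rop_scale x K u w T p e j vs gf) mulrA.
    by rewrite exchange_big /=; apply: eq_bigr => g _; rewrite mulr_sumr.
  rewrite PE /A -sumrN -big_split -sumrB; apply: eq_bigr => f fm.
  have fm' := fm; rewrite inE in fm'; case/andP: fm' => _ /eqP fm'.
  have -> : Kop x K mu w m f u T p vs = altsum f (fun g => Kfg x K mu w m f g u) T p vs.
    by rewrite /Kop fm' -[X in X == _]addn0 -addn1 eqn_add2l.
  rewrite -(altsum_K_rest K_sub cell_unit u_smooth mu_span w_def T_cell T_p vs fm mn rho0).
  rewrite /altsum -sumrN -!big_split; apply: eq_bigr => g _ /=.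
  by rewrite Kfg_split -mulrN -!mulrDr.
rewrite CmE Cm1E K1E K2E.
by rewrite opprD addrACA !addrA.
Qed.
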